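(* Let $M>0$, let $E$ be an arbitrary measurable subset of the unit circle $T$, and let $f$ be a complex-valued function on $E$. Assume that there exists a bounded analytic function $g$ in $\Delta$ whose boundary function coincides with $f$ almost everywhere on $E$. Assume furthermore that there exists a sequence $\{f_n\}$ of continuous complex-valued functions on $T$ such that: (i) $|f_n(z)| \leq M$ for all $z \in T$ and $n = 1, 2, \ldots$, and $\{f_n\}$ converges pointwise to $f$ at each point of $E$; and (iii) $\{f_n\}$ converges almost everywhere on $T \setminus E$ to the boundary function of $g$. Then there exists a sequence of polynomials $\{P_n\}$ converging pointwise to $f$ at each point of $E$ and satisfying $|P_n(z)| \leq M$ for all $z \in \Delta$ and $n = 1, 2, \ldots$.
   Context: $\Delta$ denotes the open unit disc in $\mathbb{C}$ and $T$ the unit circle; measurability and ''almost everywhere'' on $T$ refer to Lebesgue (arc length) measure. Polynomials are polynomials in the complex variable $z$ with complex coefficients. By Fatou's theorem, each bounded analytic function $g$ in $\Delta$ has a radial boundary function, defined for almost every $e^{i\theta} \in T$ by $g(e^{i\theta}) = \lim_{r \to 1^-} g(re^{i\theta})$. *)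

(* Defs.v *)
From HB Require Import structures.
From mathcomp Require Import all_boot all_order all_algebra.
From mathcomp Require Import all_classical all_reals all_analysis.
From mathcomp Require Import complex.

Set Implicit Arguments.
Unset Strict Implicit.
Unset Printing Implicit Defensive.

Import Order.TTheory GRing.Theory Num.Theory.
Import numFieldNormedType.Exports.

Local Open Scope classical_set_scope.
Local Open Scope ring_scope.
Local Open Scope complex_scope.

(* The complex plane [R[i]] with the topology of its modulus, as a normed space
   over itself.  Hence the increment in [derivable g z 1] is a complex number,
   and [derivable g z 1] is complex differentiability of [g] at [z]. *)
HB.instance Definition _ (R : rcfType) := GRing.ComAlgebra.copy R[i] R[i]^o.
HB.instance Definition _ (R : rcfType) := Vector.copy R[i] R[i]^o.
HB.instance Definition _ (R : rcfType) := NormedModule.copy R[i] R[i]^o.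

Section UnitDisc.
Context {R : realType}.
Implicit Types (t r : R) (z w : R[i]) (A : set R[i]) (g : R[i] -> R[i]).

Definition unit_disc : set R[i] := [set z | `|z| < 1].

Definition unit_circle : set R[i] := [set z | `|z| = 1].

Definition cis t : R[i] := cos t +i* sin t.

Definition angles A : set R := [set t | 0 <= t < 2 * pi /\ A (cis t)].

(* Lebesgue measurability (Caratheodory measurability for the Lebesgue outer
   measure), as opposed to Borel measurability. *)
Definition circle_measurable A : Prop :=
  A `<=` unit_circle /\ (wlength idfun)^*%mu.-cara.-measurable (angles A).

Definition circle_ae (P : R[i] -> Prop) : Prop :=
  {ae @lebesgue_measure R, forall t : R, 0 <= t < 2 * pi -> P (cis t)}.

Definition bounded_analytic g : Prop :=
  (forall z, unit_disc z -> derivable g z 1) /\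
  (exists B : R, forall z, unit_disc z -> `|g z| <= B%:C).

(* The graph of the boundary function of [g]: that function is partial, and its
   value at a point [z] of the unit circle, when defined, is [w]. *)
Definition boundary_value g z w : Prop :=
  g (r%:C * z) @[r --> 1^'-] --> w.

End UnitDisc.

(* Main.v *)
Require Import Defs.
From HB Require Import structures.
From mathcomp Require Import all_boot all_order all_algebra.
From mathcomp Require Import all_classical all_reals all_analysis.
From mathcomp Require Import complex.
From mathcomp Require Import ring lra.

Set Implicit Arguments.
Unset Strict Implicit.
Unset Printing Implicit Defensive.

Import Order.TTheory GRing.Theory Num.Theory.
Import numFieldNormedType.Exports.

Local Open Scope classical_set_scope.
Local Open Scope ring_scope.
Local Open Scope complex_scope.

(** Write u* for the boundary function of g.  At almost every point of the
circle F n converges to u*, and at every point of E it converges to f.  An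
average of finitely many functions F n, all with large index, is therefore
still close to f at each point of E, so it suffices to show that such an
average can be chosen uniformly close, on the whole circle, to a polynomial
bounded by M ([convex_approximation]).  The uniformity is what rescues the
points of the exceptional null set, where nothing is known about g.

By duality this is quick: a measure separating the averages from the ball of
radius M of the disc algebra splits into an absolutely continuous part, on
which F n converges to u*, and a singular part, on which the theorem of F. and
M. Riesz lets polynomials bounded by M do as well as any function bounded by M.
The proof below is a direct construction with the same two halves.

- Off a small set, F n is close to a polynomial G bounded by M
  ([polynomial_close_off_cover]).  The functions F n - g(r_n z) are bounded and
  tend to 0 almost everywhere when r_n tends to 1, and g(r z) has no Fourier
  coefficient of negative index, by Cauchy's theorem ([cauchy_circle]).  So the
  negative coefficients of F n tend to 0 ([negative_coefficients]), and F n is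
  a Cauchy sequence in mean ([cauchy_in_mean]); G is the analytic part of a
  Cesaro mean of some F m with m much larger than n.
- On a small set, every continuous function bounded by M can be imitated
  ([polynomial_correction]): once F n and G are fixed, for each family of arcs of
  small enough total length there is a polynomial h bounded by M that is close
  to F n on these arcs and close to G off another small set.

Choosing indices n_1, n_2, up to n_m in this order and the corrections in the
reverse order yields polynomials h_i, bounded by M, such that the sets where h_i
is far from F n_i are pairwise disjoint ([disjoint_bad_sets]).  At each point at most
one of the m differences h_i - F n_i is large, hence the average of the h_i
differs from the average of the F n_i by little more than 2 M / m.

Means over the circle are taken over the N-th roots of unity with N large.  This
makes Fourier analysis a matter of finite sums; Lebesgue integrals are only
needed for dominated convergence and for Cauchy's theorem.  The size of a subset
of the circle is measured by the total radius of finitely many discs covering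
it ([covered]). *)

Import Normc.
Local Notation Re := (@complex.Re _).
Local Notation Im := (@complex.Im _).
Local Notation "z ^*" := (@conjc _ z) : ring_scope.

(** * Modulus, real part and the unit circle *)

Section Basics.
Context {R : realType}.
Implicit Types (z w : R[i]) (r t : R).

Lemma normc_norm z : `|z| = (normc z)%:C.
Proof. by case: z => a b; rewrite normc_def. Qed.

Lemma norm_leC z r : (`|z| <= r%:C) = (normc z <= r).
Proof. by rewrite normc_norm lecR. Qed.

Lemma norm_ltC z r : (`|z| < r%:C) = (normc z < r).
Proof. by rewrite normc_norm ltcR. Qed.

Lemma normcD z w : normc (z + w) <= normc z + normc w.
Proof. by rewrite -lecR rmorphD /= -!normc_norm ler_normD. Qed.

Lemma normcN z : normc (- z) = normc z.
Proof. by apply: complexI; rewrite -!normc_norm normrN. Qed.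

Lemma normcB z w : normc (z - w) <= normc z + normc w.
Proof. by rewrite -(normcN w) normcD. Qed.

Lemma normcBC z w : normc (z - w) = normc (w - z).
Proof. by rewrite -normcN opprB. Qed.

Lemma normc_tri w z u : normc (z - u) <= normc (z - w) + normc (w - u).
Proof. by have := normcD (z - w) (w - u); rewrite addrA subrK. Qed.

Lemma normcX z n : normc (z ^+ n) = normc z ^+ n.
Proof.
elim: n => [|n IH]; first by rewrite !expr0 normc1.
by rewrite !exprS normcM IH.
Qed.

Lemma normc_ge0 z : 0 <= normc z.
Proof. by case: z => a b; exact: sqrtr_ge0. Qed.

Lemma normc_real r : normc r%:C = `|r|.
Proof. by rewrite /normc /= expr0n addr0 sqrtr_sqr. Qed.

Lemma normc_pos r : 0 <= r -> normc r%:C = r.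
Proof. by move=> r0; rewrite normc_real ger0_norm. Qed.

Lemma normc_nat n : normc (n%:R : R[i]) = n%:R.
Proof. by rewrite -(rmorph_nat (real_complex R)) normc_pos. Qed.

Lemma normc_conj z : normc z^* = normc z.
Proof. by case: z => a b /=; rewrite sqrrN. Qed.

Lemma normc_sqr z : (normc z) ^+ 2 = Re z ^+ 2 + Im z ^+ 2.
Proof. by case: z => a b /=; rewrite sqr_sqrtr // addr_ge0 ?sqr_ge0. Qed.

Lemma Re_normc z : `|Re z| <= normc z.
Proof.
rewrite -(@ler_pXn2r _ 2) ?nnegrE ?normc_ge0 // normc_sqr real_normK ?num_real //.
by rewrite lerDl sqr_ge0.
Qed.

Lemma Im_normc z : `|Im z| <= normc z.
Proof.
rewrite -(@ler_pXn2r _ 2) ?nnegrE ?normc_ge0 // normc_sqr real_normK ?num_real //.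
by rewrite lerDr sqr_ge0.
Qed.

Lemma Re_le_normc z : Re z <= normc z.
Proof. exact: le_trans (ler_norm _) (Re_normc z). Qed.

Lemma normc_ReIm z : normc z <= `|Re z| + `|Im z|.
Proof.
rewrite -(@ler_pXn2r _ 2) ?nnegrE ?normc_ge0 ?addr_ge0 //.
rewrite normc_sqr sqrrD !real_normK ?num_real //.
have := mulr_ge0 (normr_ge0 (Re z)) (normr_ge0 (Im z)); lra.
Qed.

Lemma mul_conjc z : z * z^* = ((normc z) ^+ 2)%:C.
Proof. by rewrite rmorphXn /= -normc_norm sqr_normc. Qed.

Lemma normc_gt0 z : (0 < normc z) = (z != 0).
Proof.
rewrite lt_neqAle normc_ge0 andbT eq_sym; congr (~~ _); apply/eqP/eqP => [|->].
  exact: eq0_normc.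
exact: normc0.
Qed.

Lemma normc_sum I (s : seq I) (P : pred I) (f : I -> R[i]) :
  normc (\sum_(i <- s | P i) f i) <= \sum_(i <- s | P i) normc (f i).
Proof.
elim/big_rec2: _ => [|i a b _ h]; first by rewrite normc0.
by apply: le_trans (normcD _ _) _; rewrite lerD2l.
Qed.

Lemma Re_sum I (s : seq I) (P : pred I) (f : I -> R[i]) :
  Re (\sum_(i <- s | P i) f i) = \sum_(i <- s | P i) Re (f i).
Proof. by elim/big_rec2: _ => [//|i a b _ <-]; case: (f i) b => ? ? []. Qed.

Lemma ReD z w : Re (z + w) = Re z + Re w. Proof. by case: z w => ? ? []. Qed.
Lemma ImD z w : Im (z + w) = Im z + Im w. Proof. by case: z w => ? ? []. Qed.
Lemma ReN z : Re (- z) = - Re z. Proof. by case: z. Qed.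
Lemma ImN z : Im (- z) = - Im z. Proof. by case: z. Qed.
Lemma ReB z w : Re (z - w) = Re z - Re w. Proof. by rewrite ReD ReN. Qed.
Lemma ImB z w : Im (z - w) = Im z - Im w. Proof. by rewrite ImD ImN. Qed.
Lemma ReZ r z : Re (r%:C * z) = r * Re z.
Proof. by case: z => a b /=; rewrite mul0r subr0. Qed.
Lemma ImZ r z : Im (r%:C * z) = r * Im z.
Proof. by case: z => a b /=; rewrite mul0r addr0. Qed.

Lemma cisD s t : cis (s + t) = cis s * cis t :> R[i].
Proof. by rewrite /cis cosD sinD; apply/eqP; rewrite eq_complex /= eqxx addrC eqxx. Qed.

Lemma cis0 : cis 0 = 1 :> R[i].
Proof. by rewrite /cis cos0 sin0. Qed.

Lemma cis2pi : cis (2 * pi) = 1 :> R[i].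
Proof. by rewrite /cis mulr_natl cos2pi sin2pi. Qed.

Lemma normc_cis t : normc (cis t : R[i]) = 1.
Proof. by rewrite /cis /= cos2Dsin2 sqrtr1. Qed.

Lemma cisX t n : cis t ^+ n = cis (t *+ n) :> R[i].
Proof.
elim: n => [|n IH]; first by rewrite expr0 mulr0n cis0.
by rewrite exprS IH mulrS cisD.
Qed.

Lemma circleE z : unit_circle z <-> normc z = 1.
Proof.
rewrite /unit_circle /= normc_norm; split => [|->] //.
by move=> /complexI.
Qed.

Lemma circle_cis t : unit_circle (cis t : R[i]).
Proof. by apply/circleE; exact: normc_cis. Qed.

(** The angle is [acos] of the real part, reflected in the lower half circle. *)
Lemma circleP z : unit_circle z -> exists t, 0 <= t < 2 * pi /\ z = cis t.
Proof.
move/circleE => h; have h2 := normc_sqr z; rewrite h expr1n in h2.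
case: z h h2 => a b /= h h2.
have a1 : -1 <= a <= 1 by apply/andP; split; nra.
have [acos0 acosE] := acos_def a1.
have sE : sin (acos a) = `|b|.
  rewrite sin_acos // -sqrtr_sqr; congr Num.sqrt; lra.
have pi0 := pi_gt0 R.
have [b0|b0] := leP 0 b.
  exists (acos a); split; first lra.
  by rewrite /cis acosE sE ger0_norm.
exists (2 * pi - acos a); split.
  have : acos a != 0 by apply/eqP => a0; move: sE; rewrite a0 sin0 => /esym/normr0P; rewrite lt_eqF.
  move=> a0; lra.
rewrite mulr_natl /cis cosB sinB cos2pi sin2pi acosE sE ltr0_norm //.
by apply/eqP; rewrite eq_complex /=; apply/andP; split; apply/eqP; ring.
Qed.
End Basics.

(** * Limits and derivatives in terms of the real-valued modulus *)

Section Bridge.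
Context {R : realType}.
Implicit Types (z w : R[i]) (r t : R).

Lemma complex_gt0P (e : R[i]) : 0 < e -> exists2 r : R, 0 < r & e = r%:C.
Proof.
move=> e0; have eR : e \is Num.real by rewrite gtr0_real.
have /complex_realP[k kE] := eR.
by exists k => //; move: e0; rewrite kE ltcR.
Qed.

Lemma cvg_normcP T (G : set_system T) {FG : Filter G} (h : T -> R[i]) (l : R[i]) :
  (h @ G --> l) <-> (forall e : R, 0 < e -> \forall x \near G, normc (h x - l) < e).
Proof.
split => [/cvgrPdist_lt hl e e0|hl].
  have := hl e%:C; rewrite ltcR => /(_ e0).
  by apply: filterS => x; rewrite norm_ltC normcBC.
apply/cvgrPdist_lt => e /complex_gt0P[r r0 ->].
by apply: filterS (hl r r0) => x; rewrite norm_ltC normcBC.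
Qed.

Lemma cvg_seqP (h : nat -> R[i]) (l : R[i]) :
  (h n @[n --> \oo] --> l) <->
  (forall e : R, 0 < e -> exists N : nat, forall n, (N <= n)%N -> normc (h n - l) < e).
Proof.
split => [/cvg_normcP hl e e0|hl].
  by have [N _ hN] := hl e e0; exists N.
by apply/cvg_normcP => e e0; have [N hN] := hl e e0; exists N.
Qed.

Lemma boundary_valueP (g : R[i] -> R[i]) z w :
  boundary_value g z w <->
  (forall e : R, 0 < e -> exists2 d : R, 0 < d &
     forall r, 1 - d < r < 1 -> normc (g (r%:C * z) - w) < e).
Proof.
rewrite /boundary_value cvg_normcP; split => hl e e0.
  have [d /= d0 hd] := hl e e0; exists d => // r /andP[r1 r2].
  by apply: hd => //=; rewrite ltr_distl; lra.
have [d d0 hd] := hl e e0; exists d => //= r; rewrite /= ltr_distl => h r1.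
by apply: hd; lra.
Qed.

(** The increments of [g] are compared through [normc], so that the estimates are
statements about real numbers. *)
Definition holo_at (g : R[i] -> R[i]) z := exists c, forall e : R, 0 < e ->
  exists2 d : R, 0 < d & forall w, normc (w - z) < d ->
    normc (g w - g z - c * (w - z)) <= e * normc (w - z).

Lemma derivable_holo (g : R[i] -> R[i]) z : derivable g z 1 -> holo_at g z.
Proof.
move=> /cvg_ex[/= c /cvg_normcP hc]; exists c => e e0.
have /nbhs_ballP[d' /= /complex_gt0P[d d0 ->] hd] := hc e e0.
exists d => // w wd.
have [->|wz] := eqVneq w z.
  by rewrite !subrr mulr0 subr0 normc0 mulr0.
have wz0 : w - z != 0 by rewrite subr_eq0.
have := hd (w - z); rewrite -ball_normE /= sub0r normrN norm_ltC => /(_ wd wz0).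
rewrite scaler1 subrK => /ltW hh.
have -> : g w - g z - c * (w - z) = (w - z) * ((w - z)^-1 *: (g w - g z) - c).
  have -> : (w - z)^-1 *: (g w - g z) = (w - z)^-1 * (g w - g z) :> R[i] by [].
  by field.
by rewrite normcM mulrC ler_pM2r // normc_gt0.
Qed.

Lemma holo_continuous (h : R[i] -> R[i]) z : holo_at h z -> forall e : R, 0 < e ->
  exists2 d : R, 0 < d & forall w, normc (w - z) < d -> normc (h w - h z) < e.
Proof.
move=> [c hc] e e0; have [d d0 hcd] := hc 1 ltr01.
have c0 : 0 < normc c + 1 by have := normc_ge0 c; lra.
exists (Num.min d (e / (normc c + 1))); first by rewrite lt_min d0 divr_gt0.
move=> w; rewrite lt_min ltr_pdivlMr // => /andP[/hcd h1 h2].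
have := normcD (h w - h z - c * (w - z)) (c * (w - z)); rewrite subrK normcM; nra.
Qed.

Lemma holo_mulid (k : R[i] -> R[i]) z : holo_at k z -> holo_at (fun w => w * k w) z.
Proof.
move=> [c hc]; exists (k z + z * c) => e e0.
have z0 := normc_ge0 z; have c0 := normc_ge0 c.
have A0 : 0 < 2 * (normc z + 1) by lra.
have e1 : 0 < e / (2 * (normc z + 1)) by rewrite divr_gt0.
have [d d0 hd] := hc _ e1.
have B0 : 0 < 2 * (normc c + 1) by lra.
have e2 : 0 < e / (2 * (normc c + 1)) by rewrite divr_gt0.
exists (Num.min 1 (Num.min d (e / (2 * (normc c + 1))))); first by rewrite !lt_min ltr01 d0.
move=> w; rewrite !lt_min => /and3P[w1 /hd wd w2].
have -> : w * k w - z * k z - (k z + z * c) * (w - z) =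
    w * (k w - k z - c * (w - z)) + c * (w - z) * (w - z) by ring.
apply: le_trans (normcD _ _) _; rewrite !normcM.
have dw := normc_ge0 (w - z).
have wn : normc w <= normc z + 1 by have := normcD (w - z) z; rewrite subrK; lra.
have h1 : normc w * normc (k w - k z - c * (w - z)) <=
    (normc z + 1) * (e / (2 * (normc z + 1)) * normc (w - z)).
  by rewrite ler_pM ?normc_ge0.
have h2 : normc c * normc (w - z) * normc (w - z) <=
    (normc c + 1) * (e / (2 * (normc c + 1))) * normc (w - z).
  rewrite ler_wpM2r // ler_pM ?normc_ge0 //; first by lra.
  exact: ltW.
have E1 : (normc z + 1) * (e / (2 * (normc z + 1)) * normc (w - z)) = e / 2 * normc (w - z).
  by field; rewrite gt_eqF //; lra.
have E2 : (normc c + 1) * (e / (2 * (normc c + 1))) * normc (w - z) = e / 2 * normc (w - z).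
  by field; rewrite gt_eqF //; lra.
lra.
Qed.

Lemma holo_mulX (h : R[i] -> R[i]) z n : holo_at h z -> holo_at (fun w => w ^+ n * h w) z.
Proof.
move=> hh; elim: n => [|n /holo_mulid IH].
  by have -> : (fun w => w ^+ 0 * h w) = h by apply/funext => w; rewrite expr0 mul1r.
have -> : (fun w => w ^+ n.+1 * h w) = (fun w => w * (w ^+ n * h w)).
  by apply/funext => w; rewrite exprS mulrA.
exact: IH.
Qed.

Lemma circle_compact : compact (@unit_circle R).
Proof.
have -> : @unit_circle R = [set cis t | t in `[0, 2 * pi]%classic].
  apply/seteqP; split => [z /circleP[t [t0 ->]]|z [t _ <-]]; last exact: circle_cis.
  by exists t => //=; rewrite in_itv /=; lra.
apply: continuous_compact; last exact: segment_compact.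
apply: continuous_subspaceT => t; apply/cvg_normcP => e e0.
have e20 : 0 < e / 2 by lra.
have := @continuous_cos R t => /cvgrPdist_lt /(_ _ e20) hc.
have := @continuous_sin R t => /cvgrPdist_lt /(_ _ e20).
apply: filterS2 hc => s h1 h2.
apply: le_lt_trans (normc_ReIm _) _.
rewrite ReB ImB /= -normrN opprB -[X in _ + X]normrN opprB; lra.
Qed.

Definition unif_circle (f : R[i] -> R[i]) := forall e : R, 0 < e ->
  exists2 d : R, 0 < d & forall z w, unit_circle z -> unit_circle w ->
    normc (z - w) < d -> normc (f z - f w) < e.

(** Heine's theorem on the compact circle. *)
Lemma continuous_unif_circle f : {within unit_circle, continuous f} -> unif_circle f.
Proof.
move=> fC e e0.
have /compact_near_coveringP ncov := circle_compact.
pose P (d : R) z := unit_circle z -> forall w, unit_circle w ->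
    normc (z - w) < d -> normc (f z - f w) < e.
have : \forall d \near 0^'+, forall z, unit_circle z -> P d z.
  apply: ncov => z Tz.
  have e20 : 0 < e / 2 by lra.
  have /subspace_continuousP/(_ z Tz)/cvg_normcP/(_ _ e20) := fC.
  move=> /nbhs_ballP[d' /= /complex_gt0P[d d0 ->] hd].
  have hd' w : unit_circle w -> normc (w - z) < d -> normc (f w - f z) < e / 2.
    move=> Tw wz; apply: hd => //.
    by rewrite -ball_normE /= norm_ltC normcBC.
  have d20 : 0 < (d / 2)%:C :> R[i] by rewrite ltcR; lra.
  near=> z' dd; rewrite /P /= => Tz' w Tw zw.
  have zz' : normc (z' - z) < d / 2.
    near: z'; apply/nbhs_ballP; exists (d / 2)%:C => //= y.
    by rewrite -ball_normE /= norm_ltC normcBC.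
  have ddd : dd < d / 2 by near: dd; apply: nbhs_right_lt; lra.
  have -> : f z' - f w = (f z' - f z) - (f w - f z) by ring.
  apply: le_lt_trans (normcB _ _) _.
  have h1 : normc (f z' - f z) < e / 2 by apply: hd' => //; lra.
  have h2 : normc (f w - f z) < e / 2.
    apply: hd' => //; have := normc_tri z' w z.
    by rewrite (normcBC w z'); lra.
  lra.
move=> [d /= d0 hd]; exists (d / 2); first by rewrite divr_gt0.
move=> z w Tz Tw zw; apply: (hd (d / 2)) => //=.
  by rewrite sub0r normrN ger0_norm; lra.
by lra.
Unshelve. all: by end_near.
Qed.
End Bridge.

(** * Averages over roots of unity, maximum modulus, covers *)

Section Averages.
Context {R : realType}.
Implicit Types (z w : R[i]) (r t : R).

Definition rootu (N j : nat) : R[i] := cis (2 * pi * j%:R / N%:R).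

Definition avg (K : fieldType) (N : nat) (u : R[i] -> K) : K :=
  N%:R^-1 * \sum_(j < N) u (rootu N j).

Lemma rootu_circle N j : unit_circle (rootu N j).
Proof. exact: circle_cis. Qed.

Lemma eq_avg (K : fieldType) N (u v : R[i] -> K) :
  (forall z, unit_circle z -> u z = v z) -> avg N u = avg N v.
Proof.
move=> uv; congr (_ * _); apply: eq_bigr => j _; apply: uv.
exact: rootu_circle.
Qed.

Lemma avgD (K : fieldType) N (u v : R[i] -> K) :
  avg N (fun z => u z + v z) = avg N u + avg N v.
Proof. by rewrite /avg big_split mulrDr. Qed.

Lemma avgZ (K : fieldType) N (c : K) (u : R[i] -> K) :
  avg N (fun z => c * u z) = c * avg N u.
Proof. by rewrite /avg -mulr_sumr mulrCA. Qed.

Lemma avg_sum (K : fieldType) N I (s : seq I) (P : pred I) (f : I -> R[i] -> K) :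
  avg N (fun z => \sum_(i <- s | P i) f i z) = \sum_(i <- s | P i) avg N (f i).
Proof. by rewrite /avg exchange_big /= mulr_sumr. Qed.

Lemma avg_exchange (K : fieldType) N N' (f : R[i] -> R[i] -> K) :
  avg N (fun z => avg N' (fun w => f z w)) = avg N' (fun w => avg N (fun z => f z w)).
Proof.
by rewrite [LHS]avgZ avg_sum.
Qed.

Lemma avg_cst (K : numFieldType) N (c : K) : (0 < N)%N -> avg N (fun=> c) = c.
Proof.
move=> N0; rewrite /avg sumr_const card_ord -[c *+ N]mulr_natl mulrA mulVf ?mul1r //.
by rewrite pnatr_eq0 -lt0n.
Qed.

Lemma le_avg N (u v : R[i] -> R) :
  (forall z, unit_circle z -> u z <= v z) -> avg N u <= avg N v.
Proof.
move=> uv; rewrite /avg ler_wpM2l ?invr_ge0 ?ler0n // ler_sum // => j _.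
exact/uv/rootu_circle.
Qed.

Lemma normc_avg N (u : R[i] -> R[i]) : normc (avg N u) <= avg N (fun z => normc (u z)).
Proof.
rewrite /avg normcM normcV normc_nat ler_wpM2l ?invr_ge0 ?ler0n //.
exact: normc_sum.
Qed.

Lemma Re_avg N (u : R[i] -> R[i]) : Re (avg N u) = avg N (fun z => Re (u z)).
Proof.
rewrite /avg -(rmorph_nat (real_complex R)) -fmorphV ReZ.
by rewrite Re_sum.
Qed.

Lemma conj_avg N (u : R[i] -> R[i]) : (avg N u)^* = avg N (fun z => (u z)^*).
Proof.
rewrite /avg rmorphM fmorphV rmorph_nat rmorph_sum //=.
Qed.

Lemma cis_neq1 t : 0 < t < 2 * pi -> cis t != 1 :> R[i].
Proof.
move=> t0; have s0 : 0 < sin (t / 2) by apply: sin_gt0_pi; lra.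
apply/negP => /eqP h; have : Re (cis t) = 1 by rewrite h.
rewrite /= (splitr t) cosD; have := cos2Dsin2 (t / 2); nra.
Qed.

Lemma rootuE N j : rootu N j = rootu N 1 ^+ j.
Proof. by rewrite /rootu cisX; congr cis; rewrite -mulr_natr; ring. Qed.

Lemma rootu1X N k : (0 < k < N)%N -> rootu N 1 ^+ k != 1.
Proof.
case/andP => k0 kN; rewrite -rootuE; apply: cis_neq1.
have N0 : 0 < N%:R :> R by rewrite ltr0n (leq_trans _ kN).
have pi0 := pi_gt0 R; have k0' : 0 < k%:R :> R by rewrite ltr0n.
apply/andP; split; first by rewrite divr_gt0 // !mulr_gt0.
by rewrite ltr_pdivrMr // ltr_pM2l ?mulr_gt0 // ltr_nat.
Qed.

Lemma rootu1N N : (0 < N)%N -> rootu N 1 ^+ N = 1.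
Proof.
move=> N0; rewrite -rootuE /rootu -cis2pi; congr cis; field.
by rewrite pnatr_eq0 -lt0n.
Qed.

Lemma avg_exp N k : (0 < k < N)%N -> avg N (fun z => z ^+ k) = 0.
Proof.
move=> kN; have N0 : (0 < N)%N by case/andP: kN => a; apply: ltn_trans.
rewrite /avg.
suff -> : \sum_(j < N) rootu N j ^+ k = 0 by rewrite mulr0.
have /(mulfI)h : rootu N 1 ^+ k - 1 != 0 by rewrite subr_eq0 rootu1X.
apply: h; rewrite mulr0.
under eq_bigr do rewrite rootuE exprAC.
by rewrite -subrX1 exprAC rootu1N // expr1n subrr.
Qed.

Lemma circle_conj z : unit_circle z -> z * z^* = 1.
Proof. by move=> /circleE h; rewrite mul_conjc h expr1n. Qed.

Lemma circle_expB z k l : unit_circle z -> (l <= k)%N ->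
  z ^+ k * z^* ^+ l = z ^+ (k - l).
Proof.
by move=> Tz lk; rewrite -{1}(subnK lk) exprD -mulrA -exprMn circle_conj // expr1n mulr1.
Qed.

Lemma avg_orth N k l : (k < N)%N -> (l < N)%N ->
  avg N (fun z => z ^+ k * z^* ^+ l) = (k == l)%:R.
Proof.
move=> kN lN.
wlog lk : k l kN lN / (l <= k)%N => [hw|].
  have [?|/ltnW ?] := leqP l k; first exact: hw.
  rewrite eq_sym; have /(congr1 (@conjc R)) := hw l k lN kN ltac:(assumption).
  rewrite conj_avg conjc_nat => <-; apply: eq_avg => z Tz.
  by rewrite rmorphM !rmorphXn /= conjcK mulrC.
rewrite (@eq_avg _ _ _ (fun z => z ^+ (k - l))) => [|z Tz]; last exact: circle_expB.
have [->|kl] := eqVneq k l.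
  by rewrite subnn /= (@eq_avg _ _ _ (fun=> 1)) ?avg_cst // (leq_ltn_trans _ lN).
rewrite avg_exp // subn_gt0 ltn_neqAle eq_sym kl lk /=.
by rewrite (leq_ltn_trans (leq_subr _ _)).
Qed.

Lemma geometric_le r n : 0 <= r < 1 -> \sum_(k < n) r ^+ k <= (1 - r)^-1.
Proof.
move=> /andP[r0 r1]; have r1' : 0 < 1 - r by lra.
rewrite -[leRHS]mul1r ler_pdivlMr // mulrC.
have := subrX1 r n; have := exprn_ge0 n r0; nra.
Qed.

(** A Cauchy formula over roots of unity: multiplying by the geometric sum
replaces each monomial of [P] in the variable on the circle by the same
monomial in [z]. *)
Lemma horner_avg (P : {poly R[i]}) N z : (size P <= N)%N ->
  P.[z] = avg N (fun w => P.[w] * \sum_(k < N) z ^+ k * w^* ^+ k).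
Proof.
move=> sP; pose f (w : R[i]) := \sum_(i < size P) \sum_(k < N)
  (P`_i * z ^+ k) * (w ^+ i * w^* ^+ k).
rewrite (@eq_avg _ _ _ f) => [|w _]; last first.
  rewrite horner_coef mulr_suml; apply: eq_bigr => i _.
  by rewrite mulr_sumr; apply: eq_bigr => k _; ring.
rewrite avg_sum horner_coef; apply: eq_bigr => i _.
have iN : (i < N)%N := leq_trans (ltn_ord i) sP.
rewrite avg_sum (bigD1 (Ordinal iN)) //= big1 => [|k ki].
  by rewrite avgZ avg_orth // eqxx mulr1 addr0.
rewrite avgZ avg_orth // (_ : (i == k :> nat) = false) ?mulr0 //.
by apply/negbTE; apply: contraNneq ki => ik; apply/eqP/val_inj.
Qed.

Lemma exprn_unbounded (y c : R) : 1 < y -> exists n, c < y ^+ n.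
Proof.
move=> y1; have y10 : 0 < y - 1 by lra.
have bern n : 1 + n%:R * (y - 1) <= y ^+ n.
  elim: n => [|n IH]; first by rewrite mul0r addr0 expr0.
  rewrite exprS -natr1; have n0 : 0 <= n%:R :> R by []. 
  have := mulr_ge0 n0 (sqr_ge0 (y - 1)); nra.
exists (Num.bound (c / (y - 1))); apply: lt_le_trans (bern _).
have := unstable.ltr_bound (c / (y - 1)); rewrite ltr_pdivrMr //; lra.
Qed.

(** The maximum principle.  The formula [horner_avg] only bounds [P] at [z] by
[M / (1 - normc z)]; applied to the powers of [P] it loses the same factor each
time, which disappears after extracting roots. *)
Lemma poly_maxmod (P : {poly R[i]}) (M : R) :
  (forall z, unit_circle z -> normc P.[z] <= M) ->
  forall z, normc z <= 1 -> normc P.[z] <= M.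
Proof.
move=> PM z; rewrite le_eqVlt => /orP[/eqP/circleE/PM //|z1].
have M0 : 0 <= M.
  apply: le_trans (normc_ge0 P.[1]) (PM _ _); rewrite -cis0; exact: circle_cis.
have bnd (Q : {poly R[i]}) K : (forall w, unit_circle w -> normc Q.[w] <= K) ->
    normc Q.[z] <= K * (1 - normc z)^-1.
  move=> QK; rewrite (horner_avg z (leqnSn (size Q))).
  apply: le_trans (normc_avg _ _) _.
  rewrite -[leRHS](avg_cst (N := (size Q).+1)) //; apply: le_avg => w Tw.
  rewrite normcM ler_pM ?normc_ge0 ?QK //.
  apply: le_trans (normc_sum _ _ _) _.
  apply: le_trans (_ : \sum_(k < (size Q).+1) normc z ^+ k <= _).
    apply: ler_sum => k _; move/circleE: Tw => Tw.
    by rewrite normcM !normcX normc_conj Tw expr1n mulr1.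
  by rewrite geometric_le // normc_ge0.
have pow k : normc P.[z] ^+ k <= M ^+ k * (1 - normc z)^-1.
  rewrite -normcX -horner_exp; apply: bnd => w /PM h.
  by rewrite horner_exp normcX lerXn2r // nnegrE normc_ge0.
have [//|PzM] := leP (normc P.[z]) M.
have [M00|M00] := eqVneq M 0.
  by have := pow 1%N; rewrite M00 !expr1 mul0r; have := normc_ge0 P.[z]; lra.
have Mp : 0 < M by rewrite lt_neqAle eq_sym M00.
have y1 : 1 < normc P.[z] / M by rewrite ltr_pdivlMr // mul1r.
have [n hn] := exprn_unbounded (1 - normc z)^-1 y1.
have := pow n; have Mn : 0 < M ^+ n by rewrite exprn_gt0.
by rewrite -ler_pdivrMl // mulrC -expr_div_n leNgt hn.
Qed.

Definition arcs (S : seq (R[i] * R)) := forall p, p \in S -> unit_circle p.1 /\ 0 < p.2.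

(** The sum of the radii plays the role of the length of the set. *)
Definition covered (B : R[i] -> Prop) (eta : R) := exists S : seq (R[i] * R),
  [/\ arcs S,
      \sum_(p <- S) p.2 <= eta &
      forall z, unit_circle z -> B z -> exists2 p, p \in S & normc (z - p.1) <= p.2].

Lemma covered_sub (A B : R[i] -> Prop) eta eta' :
  (forall z, unit_circle z -> A z -> B z) -> eta <= eta' ->
  covered B eta -> covered A eta'.
Proof.
move=> AB ee [S [S1 S2 S3]]; exists S; split => //; first exact: le_trans ee.
by move=> z Tz /(AB z Tz)/(S3 z Tz).
Qed.

Lemma coveredU (A B : R[i] -> Prop) a b :
  covered A a -> covered B b -> covered (fun z => A z \/ B z) (a + b).
Proof.
move=> [S [S1 S2 S3]] [T [T1 T2 T3]]; exists (S ++ T); split.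
- by move=> p; rewrite mem_cat => /orP[/S1|/T1].
- by rewrite big_cat lerD.
- move=> z Tz [/(S3 z Tz)|/(T3 z Tz)] [p pS zp]; exists p => //;
  by rewrite mem_cat pS ?orbT.
Qed.

Lemma cis_lip s t : normc (cis s - cis t : R[i]) <= 2 * `|s - t|.
Proof.
wlog st : s t / t <= s => [hw|].
  have [/hw //|/ltW/hw] := leP t s.
  by rewrite normcBC distrC.
have cosC : {within `[t, s], continuous (@cos R)}.
  by apply: continuous_subspaceT; exact: continuous_cos.
have sinC : {within `[t, s], continuous (@sin R)}.
  by apply: continuous_subspaceT; exact: continuous_sin.
have [c _ hc] := MVT_segment st (fun x _ => is_derive_cos x) cosC.
have [d _ hd] := MVT_segment st (fun x _ => is_derive_sin x) sinC.
apply: le_trans (normc_ReIm _) _; rewrite ReB ImB /= hc hd !normrM normrN.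
have := sin_max c; have := cos_max d; have := normr_ge0 (s - t); nra.
Qed.

Lemma exists_near_rootu N z : (0 < N)%N -> unit_circle z ->
  exists2 j : 'I_N, True & normc (z - rootu N j) <= 4 * pi / N%:R.
Proof.
move=> N0 /circleP[t [/andP[t0 t1] ->]].
have N0' : 0 < N%:R :> R by rewrite ltr0n.
have pi0 := pi_gt0 R; pose x := t * N%:R / (2 * pi).
have x0 : 0 <= x by rewrite /x divr_ge0 ?mulr_ge0 // ltW.
have /andP[j1 j2] := truncn_itv x0.
have jN : (Num.truncn x < N)%N.
  rewrite -(ltr_nat R); apply: le_lt_trans j1 _.
  by rewrite /x ltr_pdivrMr ?mulr_gt0 // [_ * (2 * pi)]mulrC ltr_pM2r.
exists (Ordinal jN) => //=; apply: le_trans (cis_lip _ _) _.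
rewrite (_ : 4 * pi / N%:R = 2 * (2 * pi / N%:R)); last by ring.
rewrite ler_pM2l // (_ : t = x * (2 * pi / N%:R)); last first.
  by rewrite /x; move: (pi) pi0 => p p0; field; rewrite !gt_eqF.
rewrite (_ : _ - _ = (x - (Num.truncn x)%:R) * (2 * pi / N%:R)); last by ring.
rewrite normrM [X in _ * X]ger0_norm; last by rewrite divr_ge0 ?mulr_ge0 // ltW.
rewrite ler_piMl //; first by rewrite divr_ge0 ?mulr_ge0 // ltW.
by rewrite ger0_norm; move: j2; rewrite -natr1; lra.
Qed.

(** Chebyshev's inequality, with covers in place of measure: cut the circle into
N arcs so short that [u] varies by at most [lam / 2] on each, and keep those
on which [u] reaches [lam / 2] at the centre. *)
Lemma covered_avg (u : R[i] -> R) (mu lam : R) : 0 < lam ->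
  (forall z, unit_circle z -> 0 <= u z) ->
  (forall e : R, 0 < e -> exists2 d : R, 0 < d &
     forall z w, unit_circle z -> unit_circle w ->
       normc (z - w) < d -> `|u z - u w| < e) ->
  (exists N0, forall N, (N0 <= N)%N -> avg N u <= mu) ->
  covered (fun z => lam <= u z) (8 * pi * mu / lam).
Proof.
move=> lam0 u0 uC [N0 hN0].
have l2 : 0 < lam / 2 by lra.
have [d d0 hd] := uC _ l2.
have [p pi0 pE] : exists2 p : R, 0 < p & pi = p by exists pi; rewrite ?pi_gt0.
pose N := maxn N0.+1 (Num.bound (4 * p / d)).+1.
have NN0 : (N0 <= N)%N by rewrite /N leq_max leqnSn.
have N1 : (0 < N)%N by rewrite /N leq_max.
have N1' : 0 < N%:R :> R by rewrite ltr0n.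
have Nd : 4 * p / N%:R < d.
  rewrite ltr_pdivrMr // [d * _]mulrC -ltr_pdivrMr //.
  apply: lt_trans (unstable.ltr_bound _) _.
  by rewrite ltr_nat /N leq_max leqnn orbT.
rewrite pE; exists [seq (rootu N (nat_of_ord j), 4 * p / N%:R) | j <- enum 'I_N & lam / 2 <= u (rootu N (nat_of_ord j))].
split.
- move=> q /mapP[j _ ->] /=; split; first exact: rootu_circle.
  by rewrite divr_gt0 // mulr_gt0.
- rewrite big_map big_filter big_enum_cond /=.
  have := hN0 _ NN0; rewrite /avg ler_pdivrMl // => h.
  have h2 : \sum_(j < N | lam / 2 <= u (rootu N j)) (lam / 2) <= N%:R * mu.
    apply: le_trans h; rewrite [leRHS](bigID (fun j : 'I_N => lam / 2 <= u (rootu N j))) /=.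
    rewrite -[leLHS]addr0 lerD //; first exact: ler_sum.
    by rewrite sumr_ge0 // => j _; apply/u0/rootu_circle.
  rewrite (_ : \sum_(j < N | _) _ = (\sum_(j < N | lam / 2 <= u (rootu N j)) (lam / 2)) * (8 * p / (N%:R * lam))).
    rewrite (_ : _ / lam = (N%:R * mu) * (8 * p / (N%:R * lam))); last by field; rewrite !gt_eqF.
    by rewrite ler_wpM2r // divr_ge0 // mulr_ge0 // ltW.
  by rewrite mulr_suml; apply: eq_bigr => j _; field; rewrite !gt_eqF.
- move=> z Tz lz; have [j _ zj] := exists_near_rootu N1 Tz; rewrite pE in zj.
  exists (rootu N j, 4 * p / N%:R) => //=; apply: map_f; rewrite mem_filter mem_enum andbT.
  have := hd _ _ Tz (rootu_circle N j) (le_lt_trans zj Nd).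
  rewrite ltr_norml; lra.
Qed.

End Averages.

(** * The disc algebra *)

Section DiscAlgebra.
Context {R : realType}.
Implicit Types (z w : R[i]) (r t : R) (u v : R[i] -> R[i]).

Definition disc_algebra u := forall e : R, 0 < e ->
  exists P : {poly R[i]}, forall z, normc z <= 1 -> normc (u z - P.[z]) <= e.

Lemma disc_lim u :
  (forall e : R, 0 < e -> exists2 v, disc_algebra v &
     forall z, normc z <= 1 -> normc (u z - v z) <= e) -> disc_algebra u.
Proof.
move=> h e e0; have e20 : 0 < e / 2 by lra.
have [v dv uv] := h _ e20; have [P hP] := dv _ e20.
exists P => z z1; have := uv z z1; have := hP z z1; have := normc_tri (v z) (u z) P.[z]; lra.
Qed.

Lemma disc_ext u v : (forall z, u z = v z) -> disc_algebra u -> disc_algebra v.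
Proof. by move=> uv du e /du[P hP]; exists P => z; rewrite -uv; apply: hP. Qed.

Lemma disc_poly (P : {poly R[i]}) : disc_algebra (fun z => P.[z]).
Proof. by move=> e e0; exists P => z _; rewrite subrr normc0 ltW. Qed.

Lemma disc_cst c : disc_algebra (fun=> c).
Proof. by apply: disc_ext (disc_poly c%:P) => z; rewrite hornerC. Qed.

Lemma disc_id : disc_algebra id.
Proof. by apply: disc_ext (disc_poly 'X) => z; rewrite hornerX. Qed.

Lemma poly_bounded (P : {poly R[i]}) : exists2 B : R, 0 < B &
  forall z, normc z <= 1 -> normc P.[z] <= B.
Proof.
have S0 : 0 <= \sum_(i < size P) normc P`_i by apply: sumr_ge0 => i _; exact: normc_ge0.
exists (1 + \sum_(i < size P) normc P`_i); first by lra.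
move=> z z1; rewrite horner_coef; apply: le_trans (normc_sum _ _ _) _.
apply: le_trans (_ : \sum_(i < size P) normc P`_i <= _); last by lra.
apply: ler_sum => i _; rewrite normcM normcX ler_piMr ?normc_ge0 //.
by rewrite exprn_ile1 ?normc_ge0.
Qed.

Lemma disc_bounded u : disc_algebra u -> exists2 B : R, 0 < B &
  forall z, normc z <= 1 -> normc (u z) <= B.
Proof.
move=> /(_ 1 ltr01)[P hP]; have [B B0 hB] := poly_bounded P.
exists (B + 1); first by lra.
move=> z z1; have := hP z z1; have := hB z z1.
by have := normcD (u z - P.[z]) P.[z]; rewrite subrK; lra.
Qed.

Lemma discD u v : disc_algebra u -> disc_algebra v -> disc_algebra (fun z => u z + v z).
Proof.
move=> du dv e e0; have e20 : 0 < e / 2 by lra.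
have [P hP] := du _ e20; have [Q hQ] := dv _ e20.
exists (P + Q) => z z1; have := hP z z1; have := hQ z z1.
have := normcD (u z - P.[z]) (v z - Q.[z]).
by rewrite hornerD opprD addrACA; lra.
Qed.

Lemma discM u v : disc_algebra u -> disc_algebra v -> disc_algebra (fun z => u z * v z).
Proof.
move=> du dv; have [B B0 hB] := disc_bounded du.
have [B' B0' hB'] := disc_bounded dv.
move=> e e0.
have eB : 0 < e / (2 * (B' + 1)) by rewrite divr_gt0 //; lra.
have [P hP] := du _ eB.
have [C C0 hC] := poly_bounded P.
have eC : 0 < e / (2 * (C + 1)) by rewrite divr_gt0 //; lra.
have [Q hQ] := dv _ eC.
exists (P * Q) => z z1; rewrite hornerM.
have -> : u z * v z - P.[z] * Q.[z] = (u z - P.[z]) * v z + P.[z] * (v z - Q.[z]) by ring.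
apply: le_trans (normcD _ _) _; rewrite !normcM.
have h1 : normc (u z - P.[z]) * normc (v z) <= e / (2 * (B' + 1)) * (B' + 1).
  by rewrite ler_pM ?normc_ge0 ?hP //; have := hB' z z1; lra.
have h2 : normc P.[z] * normc (v z - Q.[z]) <= (C + 1) * (e / (2 * (C + 1))).
  by rewrite ler_pM ?normc_ge0 ?hQ //; have := hC z z1; lra.
have e1 : e / (2 * (B' + 1)) * (B' + 1) = e / 2 by field; rewrite gt_eqF //; lra.
have e2 : (C + 1) * (e / (2 * (C + 1))) = e / 2 by field; rewrite gt_eqF //; lra.
lra.
Qed.

Lemma discX u n : disc_algebra u -> disc_algebra (fun z => u z ^+ n).
Proof.
move=> du; elim: n => [|n IH].
  by apply: disc_ext (disc_cst 1) => z; rewrite expr0.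
by apply: disc_ext (discM du IH) => z; rewrite exprS.
Qed.

Lemma disc_sum I (s : seq I) (P : pred I) (f : I -> R[i] -> R[i]) :
  (forall i, P i -> disc_algebra (f i)) ->
  disc_algebra (fun z => \sum_(i <- s | P i) f i z).
Proof.
move=> df; elim: s => [|i s IH].
  by apply: disc_ext (disc_cst 0) => z; rewrite big_nil.
case Pi : (P i).
  by apply: disc_ext (discD (df i Pi) IH) => z; rewrite big_cons Pi.
by apply: disc_ext IH => z; rewrite big_cons Pi.
Qed.

Lemma normc_sqrB (K : R) w : normc (K%:C - w) ^+ 2 = K ^+ 2 - 2 * K * Re w + normc w ^+ 2.
Proof. by rewrite !normc_sqr ReB ImB /=; ring. Qed.

(** The values of [u] lie in a bounded part of the half plane of real part at
least [c], hence in a disc centred at some large [K] and of radius less than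
[K]; there the inverse is the sum of a geometric series in [1 - u / K]. *)
Lemma disc_inv u c : 0 < c -> disc_algebra u ->
  (forall z, normc z <= 1 -> c <= Re (u z)) -> disc_algebra (fun z => (u z)^-1).
Proof.
move=> c0 du uc; have [B B0 hB] := disc_bounded du.
(* K is chosen so that the squared distance of K and u is at most K ^ 2 - K c. *)
pose K := B ^+ 2 / c + 2 * c.
have K0 : 0 < K by rewrite /K; have := divr_gt0 (exprn_gt0 2 B0) c0; lra.
have Kc : B ^+ 2 <= K * c.
  by rewrite /K mulrDl divfK ?gt_eqF //; nra.
have cK : c / K < 1.
  by rewrite ltr_pdivrMr // mul1r /K; have := divr_gt0 (exprn_gt0 2 B0) c0; lra.
pose rho := Num.sqrt (1 - c / K).
have rho0 : 0 < rho by rewrite sqrtr_gt0; lra.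
have rho2 : rho ^+ 2 = 1 - c / K by rewrite sqr_sqrtr //; lra.
have rho1 : rho < 1.
  by have := divr_gt0 c0 K0; nra.
pose q z := K%:C^-1 * (K%:C - u z).
have K0C : K%:C != 0 :> R[i] by rewrite eq_complex /= eqxx andbT gt_eqF.
have dq : disc_algebra q.
  apply: discM; first exact: disc_cst.
  apply: disc_ext (discD (disc_cst K%:C) (discM (disc_cst (-1)) du)) => z.
  by rewrite mulN1r.
have hq z : normc z <= 1 -> normc (q z) <= rho.
  move=> z1; rewrite -(@ler_pXn2r _ 2) ?nnegrE ?normc_ge0 ?(ltW rho0) // rho2.
  rewrite /q normcM normcV normc_pos ?(ltW K0) // exprMn normc_sqrB.
  have h1 := hB z z1; have h2 := uc z z1.
  have h3 : normc (u z) ^+ 2 <= B ^+ 2 by rewrite lerXn2r ?nnegrE ?normc_ge0 // ltW.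
  have -> : 1 - c / K = K^-1 ^+ 2 * (K ^+ 2 - K * c) by field; rewrite gt_eqF.
  rewrite ler_wpM2l ?sqr_ge0 //; nra.
have u0 z : normc z <= 1 -> u z != 0.
  by move=> /uc h; apply: contraTneq h => ->; rewrite /= -ltNge.
apply: disc_lim => e e0.
have [n hn] : exists n, 1 / (c * e) < rho^-1 ^+ n.
  by apply: exprn_unbounded; rewrite invf_gt1.
exists (fun z => K%:C^-1 * \sum_(k < n) q z ^+ k).
  by apply: discM; [exact: disc_cst | apply: disc_sum => k _; exact: discX].
move=> z z1.
have uq : u z = K%:C * (1 - q z) by rewrite /q; field.
have q1 : 1 - q z != 0.
  by have := u0 z z1; rewrite uq mulf_eq0 negb_or => /andP[].
have -> : (u z)^-1 - K%:C^-1 * \sum_(k < n) q z ^+ k = (u z)^-1 * q z ^+ n.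
  have /(_ (q z) n) := @subrX1 R[i] => hs.
  have -> : q z ^+ n = 1 - (1 - q z) * \sum_(k < n) q z ^+ k.
    have -> : q z ^+ n = 1 + (q z ^+ n - 1) by ring.
    by rewrite hs; ring.
  by rewrite uq; field; rewrite q1.
rewrite normcM normcV normcX.
have cu : c <= normc (u z) := le_trans (uc z z1) (Re_le_normc _).
have h1 : normc (q z) ^+ n <= rho ^+ n by rewrite lerXn2r ?nnegrE ?normc_ge0 ?hq // ltW.
have h2 : rho ^+ n <= c * e.
  move: hn; rewrite exprVn div1r ltf_pV2 ?posrE ?mulr_gt0 ?exprn_gt0 //; exact: ltW.
rewrite mulrC ler_pdivrMr ?(lt_le_trans c0) //.
apply: le_trans h1 (le_trans h2 _); rewrite [c * e]mulrC ler_wpM2l // ltW //.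
Qed.

(** The mean value property at the centre, inherited from polynomials. *)
Lemma disc_mean u : disc_algebra u -> forall e : R, 0 < e ->
  exists N0, forall N, (N0 <= N)%N -> normc (avg N u - u 0) <= e.
Proof.
move=> du e e0; have e20 : 0 < e / 2 by lra.
have [P hP] := du _ e20; exists (size P).+1 => N hN.
have N0 : (0 < N)%N by apply: leq_trans hN.
have PE : P.[0] = avg N (fun w => P.[w]).
  rewrite (horner_avg 0 (leq_trans (leqnSn _) hN)); apply: eq_avg => w _.
  case: N N0 {hN} => // N _; rewrite big_ord_recl /= big1 => [|k _].
    by rewrite !expr0 mulr1 addr0 mulr1.
  by rewrite /bump leq0n add1n expr0n /= mul0r.
have h1 : normc (avg N u - P.[0]) <= e / 2.
  rewrite PE -[- _]mulN1r -avgZ -avgD; apply: le_trans (normc_avg _ _) _.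
  rewrite -[leRHS](@avg_cst R R N) //; apply: le_avg => z /circleE z1.
  by rewrite mulN1r hP // z1.
have h2 : normc (u 0 - P.[0]) <= e / 2 by rewrite hP // normc0.
by have := normc_tri P.[0] (avg N u) (u 0); rewrite (normcBC P.[0]); lra.
Qed.

Lemma normc_expB z w n : normc z <= 1 -> normc w <= 1 ->
  normc (z ^+ n - w ^+ n) <= n%:R * normc (z - w).
Proof.
move=> z1 w1; elim: n => [|n IH]; first by rewrite !expr0 subrr normc0 mul0r.
have -> : z ^+ n.+1 - w ^+ n.+1 = z * (z ^+ n - w ^+ n) + (z - w) * w ^+ n.
  by rewrite !exprS; ring.
apply: le_trans (normcD _ _) _; rewrite !normcM normcX -natr1 mulrDl mul1r lerD //.
  by apply: le_trans IH; rewrite ler_piMl ?normc_ge0.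
by rewrite ler_piMr ?normc_ge0 // exprn_ile1 ?normc_ge0.
Qed.

Lemma poly_lip (P : {poly R[i]}) : exists2 L : R, 0 < L &
  forall z w, normc z <= 1 -> normc w <= 1 -> normc (P.[z] - P.[w]) <= L * normc (z - w).
Proof.
have S0 : 0 <= \sum_(i < size P) (normc P`_i * i%:R).
  by apply: sumr_ge0 => i _; rewrite mulr_ge0 ?normc_ge0.
exists (1 + \sum_(i < size P) (normc P`_i * i%:R)); first by lra.
move=> z w z1 w1; rewrite !horner_coef -sumrB.
apply: le_trans (normc_sum _ _ _) _; rewrite mulrDl mul1r mulr_suml.
rewrite -[leLHS]add0r lerD ?normc_ge0 //; apply: ler_sum => i _.
by rewrite -mulrBr normcM -mulrA ler_wpM2l ?normc_ge0 // normc_expB.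
Qed.

Lemma disc_unif u : disc_algebra u -> unif_circle u.
Proof.
move=> du e e0; have e30 : 0 < e / 3 by lra.
have [P hP] := du _ e30; have [L L0 hL] := poly_lip P.
exists (e / 3 / L); first by rewrite divr_gt0.
move=> z w /circleE z1 /circleE w1; rewrite ltr_pdivlMr // => zw.
have := hL z w; rewrite z1 w1 => /(_ (lexx _) (lexx _)).
have := hP z; rewrite z1 => /(_ (lexx _)); have := hP w; rewrite w1 => /(_ (lexx _)).
have := normc_tri P.[z] (u z) (u w); have := normc_tri P.[w] P.[z] (u w).
rewrite (normcBC (u w)); lra.
Qed.

End DiscAlgebra.

(** * Analytic functions of positive real part peaking on an arc *)

Section Peaks.
Context {R : realType}.
Implicit Types (a z w : R[i]) (r s t : R) (u v : R[i] -> R[i]).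

Lemma Re_invc w : Re w^-1 = Re w / normc w ^+ 2.
Proof.
rewrite normc_sqr; case: w => x y /=.
by rewrite /= mulrC.
Qed.

Lemma Re_inv_ge0 w : 0 <= Re w -> 0 <= Re w^-1.
Proof. by move=> h; rewrite Re_invc divr_ge0 // sqr_ge0. Qed.

(** It has nonnegative real part on the disc, is at least 1/4 in real part near
[a] at scale [s], and is of order [s] away from [a] and at 0. *)
Definition peak a s z : R[i] := s%:C / ((1 + s)%:C - a^* * z).

Section Peak.
Variables (a : R[i]) (s : R).
Hypotheses (Ta : unit_circle a) (s0 : 0 < s).

Let a1 : normc a = 1. Proof. exact/circleE. Qed.

Lemma peak_denom z : normc z <= 1 -> s <= Re ((1 + s)%:C - a^* * z).
Proof.
move=> z1; rewrite ReB /=.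
have := Re_le_normc (a^* * z); rewrite normcM normc_conj a1 mul1r; lra.
Qed.

Lemma disc_peak : disc_algebra (peak a s).
Proof.
apply: discM; first exact: disc_cst.
apply: (@disc_inv _ _ s) => //; last exact: peak_denom.
apply: disc_ext (discD (disc_cst (1 + s)%:C) (discM (disc_cst (- a^*)) disc_id)) => z.
by rewrite mulNr.
Qed.

Lemma peak_ge0 z : normc z <= 1 -> 0 <= Re (peak a s z).
Proof.
move=> z1; rewrite /peak ReZ mulr_ge0 ?(ltW s0) //.
by apply: Re_inv_ge0; apply: le_trans (ltW s0) (peak_denom z1).
Qed.

Lemma peak_denomE z : (1 + s)%:C - a^* * z = s%:C - a^* * (z - a).
Proof.
have aa : a^* * a = 1 by rewrite mulrC circle_conj.
by rewrite mulrBr aa rmorphD rmorph1; ring.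
Qed.

Lemma peak_near z : normc z <= 1 -> normc (z - a) <= s -> 1 / 4 <= Re (peak a s z).
Proof.
move=> z1 za; rewrite /peak ReZ Re_invc.
have h1 := peak_denom z1.
have h2 : normc ((1 + s)%:C - a^* * z) <= 2 * s.
  rewrite peak_denomE; apply: le_trans (normcB _ _) _.
  by rewrite normcM normc_conj a1 mul1r normc_pos ?(ltW s0) //; lra.
have h3 : 0 < normc ((1 + s)%:C - a^* * z).
  by apply: lt_le_trans (Re_le_normc _); apply: lt_le_trans h1.
have h4 : normc ((1 + s)%:C - a^* * z) ^+ 2 <= (2 * s) ^+ 2.
  by rewrite lerXn2r // nnegrE ?normc_ge0 // mulr_ge0 // ltW.
rewrite mulrA ler_pdivlMr ?exprn_gt0 //; nra.
Qed.

Lemma peak_far z d : 0 < d -> s <= d / 2 -> d <= normc (z - a) -> normc z <= 1 ->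
  normc (peak a s z) <= 2 * s / d.
Proof.
move=> d0 sd dz z1; rewrite /peak normcM normcV normc_pos ?(ltW s0) //.
have h : d / 2 <= normc ((1 + s)%:C - a^* * z).
  rewrite peak_denomE.
  have := normc_tri s%:C (a^* * (z - a)) 0.
  rewrite !subr0 (normcBC _ s%:C) normcM normc_conj a1 mul1r normc_pos ?(ltW s0) //; lra.
have -> : 2 * s / d = s * (d / 2)^-1 by field; rewrite gt_eqF.
by rewrite ler_wpM2l ?(ltW s0) // lef_pV2 ?posrE //; lra.
Qed.

Lemma peak0 : normc (peak a s 0) <= s.
Proof.
have sp := s0; have h : 1 <= 1 + s by lra.
have h0 : 0 <= 1 + s by lra.
rewrite /peak mulr0 subr0 normcM normcV !normc_pos ?(ltW s0) //.
by rewrite ler_pdivrMr; nra.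
Qed.

End Peak.

(** A rational substitute for the logarithm of [1 + w] on the right half plane.
Its real part grows like the logarithm of the size of [w]; its imaginary part
stays bounded, because the terms with 2^j far from the modulus of [w] on a
logarithmic scale are almost equal to 0 or to 1. *)
Definition dyadic_log (J : nat) w : R[i] := \sum_(j < J) w / ((2 ^+ j)%:C + w).

Section DyadicLog.
Variable w : R[i].
Hypothesis w0 : 0 <= Re w.

Lemma dyadic_term_denom t : 0 < t -> t <= Re (t%:C + w).
Proof. by have wp := w0; move=> t0; rewrite ReD /=; lra. Qed.

Lemma denom_sq t : 0 < t -> t ^+ 2 + normc w ^+ 2 <= normc (t%:C + w) ^+ 2.
Proof.
have wp := w0.
move=> t0; rewrite !normc_sqr ReD ImD /= add0r; nra.
Qed.

Lemma dyadic_termE t : 0 < t -> w / (t%:C + w) = 1 - t%:C / (t%:C + w).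
Proof.
move=> t0; have h : t%:C + w != 0.
  by rewrite -normc_gt0; apply: lt_le_trans (Re_le_normc _); apply: lt_le_trans (dyadic_term_denom t0).
by field.
Qed.

Lemma Re_dyadic_term t : 0 < t -> Re (w / (t%:C + w)) = 1 - t * (t + Re w) / normc (t%:C + w) ^+ 2.
Proof. by move=> t0; rewrite dyadic_termE // ReB ReZ Re_invc ReD /= mulrA. Qed.

Lemma dyadic_term_ge0 t : 0 < t -> 0 <= Re (w / (t%:C + w)).
Proof.
have wp := w0.
move=> t0; rewrite Re_dyadic_term // subr_ge0.
have t2 := exprn_gt0 2 t0.
have dp : 0 < normc (t%:C + w) ^+ 2 by apply: lt_le_trans (denom_sq t0); have := sqr_ge0 (normc w); lra.
rewrite ler_pdivrMr // mul1r; rewrite normc_sqr ReD ImD /= add0r.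
have := sqr_ge0 (Im w); nra.
Qed.

Lemma dyadic_term_half t : 0 < t -> t <= Re w -> 1 / 2 <= Re (w / (t%:C + w)).
Proof.
have wp := w0.
move=> t0 tw; rewrite Re_dyadic_term //.
have dp : 0 < normc (t%:C + w) ^+ 2.
  by apply: lt_le_trans (denom_sq t0); have := sqr_ge0 (normc w); have := exprn_gt0 2 t0; lra.
suff : t * (t + Re w) / normc (t%:C + w) ^+ 2 <= 1 / 2 by lra.
rewrite ler_pdivrMr //; rewrite normc_sqr ReD ImD /= add0r.
have := sqr_ge0 (Im w); nra.
Qed.

Lemma Im_invc z : Im z^-1 = - Im z / normc z ^+ 2.
Proof. by rewrite normc_sqr; case: z => x y /=; rewrite mulNr. Qed.

Lemma dyadic_term_Im t : 0 < t ->
  `|Im (w / (t%:C + w))| * (t ^+ 2 + normc w ^+ 2) <= t * normc w.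
Proof.
move=> t0; rewrite dyadic_termE // ImB ImZ Im_invc ImD /= !add0r.
have dp : 0 < normc (t%:C + w) ^+ 2.
  by apply: lt_le_trans (denom_sq t0); have := sqr_ge0 (normc w); have := exprn_gt0 2 t0; lra.
rewrite normrN !normrM normrN (gtr0_norm t0) normfV (gtr0_norm dp).
have := denom_sq t0; have := Im_normc w; have := normc_ge0 w.
set D := normc (t%:C + w) ^+ 2 in dp *; set x := normc w => x0 Ix hD.
rewrite -!mulrA ler_wpM2l ?(ltW t0) //.
rewrite -[leRHS]mulr1 ler_pM //.
  by rewrite mulr_ge0 ?invr_ge0 ?(ltW dp) // addr_ge0 ?sqr_ge0.
by rewrite mulrC ler_pdivrMr // mul1r.
Qed.

Lemma dyadic_log_ge0 J : 0 <= Re (dyadic_log J w).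
Proof. by rewrite Re_sum sumr_ge0 // => j _; rewrite dyadic_term_ge0 // exprn_gt0. Qed.

Lemma dyadic_log_large J : 2 ^+ J <= Re w -> J%:R / 2 <= Re (dyadic_log J w).
Proof.
move=> Jw; rewrite Re_sum; apply: le_trans (_ : \sum_(j < J) (1 / 2) <= _).
  by rewrite sumr_const card_ord -mulr_natr; lra.
apply: ler_sum => j _; rewrite dyadic_term_half ?exprn_gt0 //.
by apply: le_trans Jw; rewrite ler_eXn2l ?ltr1n // ltnW.
Qed.

Lemma dyadic_log_small J : normc (dyadic_log J w) <= 2 * normc w.
Proof.
apply: le_trans (normc_sum _ _ _) _.
apply: le_trans (_ : normc w * \sum_(j < J) (2^-1) ^+ j <= _).
  rewrite mulr_sumr; apply: ler_sum => j _.
  rewrite normcM normcV ler_wpM2l ?normc_ge0 // exprVn.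
  have h : 0 < 2 ^+ j :> R by rewrite exprn_gt0.
  have h2 := le_trans (dyadic_term_denom h) (Re_le_normc _).
  by rewrite lef_pV2 ?posrE // (lt_le_trans h).
rewrite mulrC ler_wpM2r ?normc_ge0 //.
have h : 0 <= (2^-1 : R) < 1 by lra.
by apply: le_trans (geometric_le J h) _; rewrite (_ : 1 - 2^-1 = 2^-1) ?invrK //; lra.
Qed.

(** The j-th term has imaginary part at most the smaller of [t / x] and [x / t],
where [t] is 2^j and [x] is the modulus of [w]: two geometric series, one on
each side of [x]. *)
Lemma dyadic_log_Im J : `|Im (dyadic_log J w)| <= 4.
Proof.
have ImS : Im (dyadic_log J w) = \sum_(j < J) Im (w / ((2 ^+ j)%:C + w)).
  by rewrite /dyadic_log; elim/big_rec2: _ => [//|i x y _ <-]; rewrite ImD.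
rewrite ImS; apply: le_trans (ler_norm_sum _ _ _) _.
have := normc_ge0 w; have := @dyadic_term_Im; set x := normc w => hI x0.
have [x00|xn0] := eqVneq x 0.
  rewrite big1 // => j _; have t0 : 0 < 2 ^+ j :> R by rewrite exprn_gt0.
  have := hI _ t0; rewrite x00 mulr0 expr0n addr0 => h.
  apply: le_anti; rewrite normr_ge0 andbT.
  by rewrite -(pmulr_lle0 _ (exprn_gt0 2 t0)).
have xp : 0 < x by rewrite lt_neqAle eq_sym xn0.
pose m (t : R) := `|Im (w / (t%:C + w))|.
have m1 t : 0 < t -> m t <= t / x.
  move=> t0; rewrite ler_pdivlMr //; have := hI _ t0; rewrite -/(m t).
  have := sqr_ge0 t; have : 0 <= m t by exact: normr_ge0.
  move=> m0 t2 h; have : m t * x * x <= t * x by nra.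
  by rewrite ler_pM2r.
have m2 t : 0 < t -> m t <= x / t.
  move=> t0; rewrite ler_pdivlMr //; have := hI _ t0; rewrite -/(m t).
  have := sqr_ge0 x; have : 0 <= m t by exact: normr_ge0.
  move=> m0 t2 h; have : m t * t * t <= x * t by nra.
  by rewrite ler_pM2r.
(* Partial sums of the two geometric series, before and after 2 ^ n passes x. *)
have key n : (2 ^+ n <= x -> \sum_(j < n) m (2 ^+ j) <= 2 ^+ n / x) /\
             (x < 2 ^+ n -> \sum_(j < n) m (2 ^+ j) <= 4 - 2 * x / 2 ^+ n).
  elim: n => [|n [IH1 IH2]].
    rewrite !big_ord0 expr0; split => h; first by rewrite divr_ge0.
    by rewrite divr1; lra.
  rewrite !big_ord_recr /=; have t0 : 0 < 2 ^+ n :> R by rewrite exprn_gt0.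
  rewrite exprS; move: (2 ^+ n) t0 IH1 IH2 => t t0 IH1 IH2.
  have [h|h] := leP t x.
    have h1 := IH1 h; have h2 := m1 t t0.
    have h3 : 2 * t / x = t / x + t / x by rewrite -mulrA mulr_natl mulr2n.
    split => h4; first lra.
    have h5 : t / x <= 1 by rewrite ler_pdivrMr // mul1r.
    have h6 : 2 * x / (2 * t) <= 2 by rewrite ler_pdivrMr; lra.
    lra.
  split => h4; first lra.
  have h1 := IH2 h; have h2 := m2 t t0.
  have -> : 2 * x / (2 * t) = x / t by field; rewrite gt_eqF.
  have : 2 * x / t = x / t + x / t by rewrite -mulrA mulr_natl mulr2n.
  lra.
have [k1 k2] := key J; have [h|h] := leP (2 ^+ J) x.
  by apply: le_trans (k1 h) _; rewrite ler_pdivrMr //; lra.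
apply: le_trans (k2 h) _; have := divr_ge0 (ltW xp) (ltW (exprn_gt0 J (ltr0Sn R 1))); lra.
Qed.

End DyadicLog.

Lemma disc_dyadic_log J u : disc_algebra u -> (forall z, normc z <= 1 -> 0 <= Re (u z)) ->
  disc_algebra (fun z => dyadic_log J (u z)).
Proof.
move=> du u0; apply: disc_sum => j _; apply: discM => //.
have t0 : 0 < 2 ^+ j :> R by rewrite exprn_gt0.
apply: (disc_inv t0); first by apply: discD => //; exact: disc_cst.
by move=> z /u0 h; exact: dyadic_term_denom.
Qed.

End Peaks.

(** * Polynomials imitating a continuous function on a small set *)

Section Mixing.
Context {R : realType}.
Variables (p : nat) (T : R) (G : R[i]) (c V : 'I_p -> R[i]).
Hypotheses (T0 : 0 < T) (V0 : forall i, 0 <= Re (V i)) (VI : forall i, `|Im (V i)| <= 4).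

Let A : R := \sum_(i < p) Re (V i).
(** If the [V i] were nonnegative reals, [mix] would be an average of [G] and the
[c i].  Their imaginary parts are bounded, so for large [T] the moduli of the
weights add up to little more than the modulus of the denominator. *)
Definition mix : R[i] := (T%:C * G + \sum_(i < p) c i * V i) / (T%:C + \sum_(i < p) V i).

Lemma mix_weight_ge0 : 0 <= A.
Proof. by apply: sumr_ge0 => i _; exact: V0. Qed.

Lemma mix_denom : T + A <= Re (T%:C + \sum_(i < p) V i).
Proof. by rewrite ReD Re_sum. Qed.

Lemma mix_modulus : \sum_(i < p) normc (V i) <= A + 4 * p%:R.
Proof.
rewrite /A mulr_natr -[X in _ *+ X](card_ord p) -sumr_const -big_split /=.
apply: ler_sum => i _; apply: le_trans (normc_ReIm _) _.
by rewrite ger0_norm ?V0 // lerD2l.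
Qed.

Lemma mix_dist z : normc (mix - z) * (T + A) <=
  T * normc (G - z) + \sum_(i < p) normc (c i - z) * normc (V i).
Proof.
have TA : 0 < T + A by have := mix_weight_ge0; have := T0; lra.
have D0 : T%:C + \sum_(i < p) V i != 0.
  by rewrite -normc_gt0; apply: lt_le_trans (Re_le_normc _); apply: lt_le_trans mix_denom.
have E : (mix - z) * (T%:C + \sum_(i < p) V i) =
    T%:C * (G - z) + \sum_(i < p) (c i - z) * V i.
  rewrite /mix mulrBl divfK // mulrDr mulrBr mulr_sumr opprD addrACA [z * T%:C]mulrC.
  by congr (_ + _); rewrite -sumrB; apply: eq_bigr => i _; rewrite mulrBl.
apply: le_trans (_ : normc (mix - z) * normc (T%:C + \sum_(i < p) V i) <= _).
  by rewrite ler_wpM2l ?normc_ge0 // (le_trans mix_denom) // Re_le_normc.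
rewrite -normcM E; apply: le_trans (normcD _ _) _.
rewrite normcM normc_pos ?(ltW T0) // lerD2l.
by apply: le_trans (normc_sum _ _ _) _; apply: ler_sum => i _; rewrite normcM.
Qed.

End Mixing.

Section Correction.
Context {R : realType}.
Implicit Types (a z w : R[i]) (r s t : R) (u v : R[i] -> R[i]).

Lemma le_term_sum S q (c : pred (R[i] * R)) (f : R[i] * R -> R) :
  (forall x, x \in S -> 0 <= f x) -> q \in S -> c q -> f q <= \sum_(x <- S | c x) f x.
Proof.
move=> f0 qS cq; rewrite (big_rem q qS) /= cq.
rewrite lerDl big_seq_cond sumr_ge0 // => x /andP[xS _]; apply: f0.
exact: mem_rem xS.
Qed.

(** The polynomial approximates the mixture of [G], with weight [T], and of the
values of [F] at [p] equally spaced points, with weights [V i].  The weight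
[V i] is the dyadic logarithm of a large multiple of the sum of the peaks on the
arcs near the i-th point.  On the arcs some weight beats [T]; the weights of
distant points are negligible there, so the mixture is close to [F].  In the
mean all weights are small, so the mixture is close to [G] off a small set. *)
Lemma polynomial_correction (M : R) (F : R[i] -> R[i]) (G : {poly R[i]}) (eps eta : R) :
  0 < M -> unif_circle F -> (forall z, unit_circle z -> normc (F z) <= M) ->
  (forall z, normc z <= 1 -> normc G.[z] <= M) -> 0 < eps -> 0 < eta ->
  exists2 delta : R, 0 < delta & forall S, arcs S -> \sum_(q <- S) q.2 <= delta ->
  exists h : {poly R[i]},
  [/\ forall z, normc z <= 1 -> normc h.[z] <= M,
      forall z, unit_circle z -> (exists2 q, q \in S & normc (z - q.1) <= q.2) ->
        normc (h.[z] - F z) <= eps &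
      covered (fun z => eps <= normc (h.[z] - G.[z])) eta].
Proof.
move=> M0 Fu FM GM e0 eta0.
have e40 : 0 < eps / 4 by lra.
have [d3 d30 hd3] := Fu _ e40.
(* F varies by less than eps / 4 at scale 4 d; the points zeta i are d-dense. *)
pose d := d3 / 4; have d0 : 0 < d by rewrite /d; lra.
have dE : d3 = 4 * d by rewrite /d; lra.
clearbody d.
pose p := (Num.bound (4 * pi / d)).+1.
have pp : (0 < p)%N by [].
have p0 : 0 < p%:R :> R by rewrite ltr0n.
have pd : 4 * pi / p%:R <= d.
  have h : 4 * pi / d < p%:R.
    by apply: lt_trans (unstable.ltr_bound _) _; rewrite ltr_nat.
  by rewrite ler_pdivrMr // [d * _]mulrC -ler_pdivrMr // ltW.
clearbody p.
(* T makes the relative excess 4 p / T of the weights at most eps / (10 M). *)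
pose T := 40 * M * p%:R / eps + 4 * p%:R.
have T1 : 4 * p%:R <= T.
  by rewrite /T lerDr divr_ge0 ?mulr_ge0 // ltW.
have T2 : 40 * M * p%:R <= eps * T.
  have -> : eps * T = 40 * M * p%:R + eps * (4 * p%:R) by rewrite /T; field; rewrite gt_eqF.
  by rewrite lerDl !mulr_ge0 // ltW.
have T0 : 0 < T by lra.
clearbody T.
(* J / 2 is a lower bound for the total weight of the values of F on the arcs. *)
pose J := (Num.bound (24 * M * T / eps)).+1.
have J1 : 12 * M * T <= eps * (J%:R / 2).
  have : 24 * M * T / eps < J%:R.
    by apply: lt_trans (unstable.ltr_bound _) _; rewrite ltr_nat.
  rewrite ltr_pdivrMr // => h; lra.
clearbody J.
pose N : R := 4 * 2 ^+ J.
have N0 : 0 < N by rewrite /N mulr_gt0 // exprn_gt0.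
have NE : 2 ^+ J = N * (1 / 4) by rewrite /N; field.
clearbody N.
(* If the h below is farther than eps from G, the total weight is at least lam. *)
pose lam := eps * T / (4 * M).
have lam0 : 0 < lam by rewrite /lam divr_gt0 ?mulr_gt0.
have lamE : lam * (4 * M) = eps * T by rewrite /lam divfK // gt_eqF // mulr_gt0.
clearbody lam.
(* Below d1 the distant weights are harmless; below d2 the mean weight is small
   enough for Chebyshev's inequality. *)
pose d1 := T * d / (8 * N * p%:R).
have d10 : 0 < d1 by rewrite /d1 divr_gt0 ?mulr_gt0.
have [pi' pi0 piE] : exists2 pi' : R, 0 < pi' & pi = pi' by exists pi; rewrite ?pi_gt0.
pose d2 := eta * lam / (24 * pi' * p%:R * N).
have d20 : 0 < d2 by rewrite /d2 divr_gt0 ?mulr_gt0.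
pose delta := Num.min (d / 2) (Num.min d1 d2).
have delta0 : 0 < delta by rewrite /delta !lt_min d10 d20 andbT; lra.
exists delta => // S aS Sdelta.
have S0 q : q \in S -> 0 <= q.2 by move=> /aS[_ /ltW].
have SI (c : pred (R[i] * R)) : 0 <= \sum_(q <- S | c q) q.2 <= delta.
  rewrite big_seq_cond sumr_ge0 => [|q /andP[/S0]//] /=.
  apply: le_trans Sdelta; rewrite [leRHS]big_seq_cond [leRHS](bigID c) /=.
  rewrite (eq_bigl (fun q => (q \in S) && true && c q)) => [|q]; last by rewrite andbT.
  by rewrite lerDl sumr_ge0 // => q /andP[/andP[/S0]].
have [dd1 [dd2 dd3]] : delta <= d / 2 /\ delta <= d1 /\ delta <= d2.
  by split; [|split]; rewrite /delta !ge_min lexx ?orbT.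
pose zeta (i : 'I_p) := rootu p i : R[i].
(* An arc may be attached to several points zeta i. *)
pose c (i : 'I_p) (q : R[i] * R) := normc (q.1 - zeta i) <= d.
pose W i z := N%:C * \sum_(q <- S | (q \in S) && c i q) peak q.1 q.2 z.
have Wdisc i : disc_algebra (W i).
  apply: discM; first exact: disc_cst.
  by apply: disc_sum => q /andP[/aS[q1 q2] _]; exact: disc_peak.
have ReW i z : normc z <= 1 ->
    Re (W i z) = N * \sum_(q <- S | (q \in S) && c i q) Re (peak q.1 q.2 z).
  by move=> z1; rewrite /W ReZ Re_sum.
have W0 i z : normc z <= 1 -> 0 <= Re (W i z).
  move=> z1; rewrite ReW // mulr_ge0 ?(ltW N0) // sumr_ge0 // => q /andP[/aS[q1 q2] _].
  exact: peak_ge0.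
have Wz0 i : normc (W i 0) <= N * delta.
  rewrite /W normcM normc_pos ?(ltW N0) // ler_wpM2l ?(ltW N0) //.
  apply: le_trans (normc_sum _ _ _) _.
  have /andP[_] := SI (fun q => (q \in S) && c i q); apply: le_trans.
  by apply: ler_sum => q /andP[/aS[q1 q2] _]; exact: peak0.
have Wfar i z : normc z <= 1 -> 2 * d <= normc (z - zeta i) ->
    normc (W i z) <= 2 * N * delta / d.
  move=> z1 far; rewrite /W normcM normc_pos ?(ltW N0) //.
  rewrite (_ : 2 * N * delta / d = N * (2 * delta / d)); last by ring.
  rewrite ler_wpM2l ?(ltW N0) //; apply: le_trans (normc_sum _ _ _) _.
  apply: le_trans (_ : \sum_(q <- S | (q \in S) && c i q) (2 / d * q.2) <= _); last first.
    rewrite -mulr_sumr [2 * delta / d]mulrAC ler_wpM2l ?divr_ge0 ?(ltW d0) //.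
    by have /andP[_] := SI (fun q => (q \in S) && c i q).
  apply: ler_sum => q /andP[qS ciq]; have [q1 q2] := aS q qS.
  rewrite mulrAC; apply: peak_far => //.
    apply: le_trans dd1; have /andP[_] := SI predT; apply: le_trans.
    by apply: le_term_sum.
  by have := normc_tri q.1 z (zeta i); rewrite /c in ciq; lra.
pose V i z := dyadic_log J (W i z).
have Vdisc i : disc_algebra (V i) by apply: disc_dyadic_log => // z; exact: W0.
have V0 z : normc z <= 1 -> forall i, 0 <= Re (V i z).
  by move=> z1 i; apply: dyadic_log_ge0; exact: W0.
have VI z : normc z <= 1 -> forall i, `|Im (V i z)| <= 4.
  by move=> z1 i; apply: dyadic_log_Im; exact: W0.
pose A z := \sum_(i < p) Re (V i z).
have A0 z : normc z <= 1 -> 0 <= A z by move=> z1; apply: sumr_ge0 => i _; exact: V0.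
pose h0 z := mix T G.[z] (fun i => F (zeta i)) (fun i => V i z).
have Udisc : disc_algebra (fun z => \sum_(i < p) V i z) by apply: disc_sum.
have h0disc : disc_algebra h0.
  apply: discM.
    apply: discD; first by apply: discM; [exact: disc_cst | exact: disc_poly].
    by apply: disc_sum => i _; apply: discM => //; exact: disc_cst.
  apply: (disc_inv T0); first by apply: discD => //; exact: disc_cst.
  move=> z z1; apply: le_trans (mix_denom _ _); rewrite lerDl; exact: A0.
have cM i : normc (F (zeta i)) <= M by apply: FM; exact: rootu_circle.
have h0M z : normc z <= 1 -> normc (h0 z) <= M * (1 + 4 * p%:R / T).
  move=> z1; have := mix_dist G.[z] (fun i => F (zeta i)) T0 (V0 z z1) 0.
  rewrite -/(h0 z) -/(A z) !subr0 => hh.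
  have h1 : \sum_(i < p) normc (F (zeta i) - 0) * normc (V i z) <= M * (A z + 4 * p%:R).
    apply: le_trans (_ : \sum_(i < p) M * normc (V i z) <= _).
      by apply: ler_sum => i _; rewrite subr0 ler_wpM2r ?normc_ge0.
    by rewrite -mulr_sumr ler_wpM2l ?(ltW M0) // mix_modulus //; [exact: V0 | exact: VI].
  have h2 : T * normc G.[z] <= T * M by rewrite ler_wpM2l ?(ltW T0) ?GM.
  have Az := A0 z z1; have TA : 0 < T + A z by lra.
  rewrite -(ler_pM2r TA); apply: le_trans hh _.
  apply: le_trans (_ : T * M + M * (A z + 4 * p%:R) <= _); first by rewrite lerD.
  have -> : M * (1 + 4 * p%:R / T) * (T + A z) =
     T * M + M * (A z + 4 * p%:R) + M * (4 * p%:R / T) * A z by field; rewrite gt_eqF.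
  by rewrite lerDl !mulr_ge0 // ?invr_ge0 ?(ltW M0) ?(ltW T0).
(* The mixture exceeds M by a factor 1 + k; the polynomial is scaled back. *)
pose k := 4 * p%:R / T.
have k0 : 0 < k by rewrite /k divr_gt0 ?mulr_gt0.
have kM : 10 * (M * k) <= eps.
  by rewrite /k mulrA mulrA ler_pdivrMr //; lra.
have kE : k * T = 4 * p%:R by rewrite /k divfK // gt_eqF.
rewrite -/k in h0M; clearbody k.
have Mk0 : 0 < M * k by rewrite mulr_gt0.
have [h1 hh1] := h0disc _ Mk0.
have h1M z : normc z <= 1 -> normc h1.[z] <= M * (1 + 2 * k).
  move=> z1; have := hh1 z z1; have := h0M z z1.
  by have := normc_tri (h0 z) h1.[z] 0; rewrite !subr0 (normcBC h1.[z]); lra.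
have k12 : 0 < 1 + 2 * k by lra.
pose h := (1 + 2 * k)^-1%:C *: h1.
have hM z : normc z <= 1 -> normc h.[z] <= M.
  move=> z1; rewrite /h hornerZ normcM normc_pos ?invr_ge0 ?(ltW k12) //.
  by rewrite mulrC ler_pdivrMr // h1M.
have hh0 z : normc z <= 1 -> normc (h.[z] - h0 z) <= 3 * (M * k).
  move=> z1; have := hh1 z z1; rewrite normcBC => hA.
  apply: le_trans (normc_tri h1.[z] _ _) _.
  suff : normc (h.[z] - h1.[z]) <= 2 * (M * k) by lra.
  have -> : h.[z] - h1.[z] = - ((2 * k / (1 + 2 * k))%:C * h1.[z]).
    have kk : (1 + 2 * k)^-1 - 1 = - (2 * k / (1 + 2 * k)) by field; rewrite gt_eqF.
    rewrite -mulNr -rmorphN -kk rmorphB rmorph1 mulrBl mul1r; congr (_ - _).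
    by rewrite /h hornerZ.
  rewrite normcN normcM normc_pos; last by rewrite divr_ge0 ?mulr_ge0 ?(ltW k0) ?(ltW k12) //.
  have -> : 2 * (M * k) = 2 * k / (1 + 2 * k) * (M * (1 + 2 * k)) by field; rewrite gt_eqF.
  rewrite ler_wpM2l ?h1M // divr_ge0 ?mulr_ge0 ?(ltW k0) ?(ltW k12) //.
exists h; split => //.
- move=> z Tz [q qS zq].
  have z1 : normc z <= 1 by move/circleE: Tz => ->.
  have [q1 q2] := aS q qS.
  have qd : q.2 <= d / 2.
    by apply: le_trans dd1; have /andP[_] := SI predT; apply: le_trans; exact: le_term_sum.
  have [i0 _ hi0] := exists_near_rootu pp q1.
  have ci0 : c i0 q by apply: le_trans hi0 _.
  have Az : J%:R / 2 <= A z.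
    rewrite /A (bigD1 i0) //=; apply: le_trans (_ : Re (V i0 z) <= _); last first.
      by rewrite lerDl sumr_ge0 // => i _; exact: V0.
    apply: dyadic_log_large; first exact: W0.
    rewrite ReW //; rewrite NE.
    rewrite ler_wpM2l ?(ltW N0) //.
    apply: le_trans (peak_near q1 q2 z1 zq) _.
    apply: (le_term_sum (f := fun q => Re (peak q.1 q.2 z))) => //; last by rewrite qS.
    by move=> x /aS[x1 x2]; exact: peak_ge0.
  pose tau := 4 * N * delta / d.
  have tau0 : 0 <= tau by rewrite /tau divr_ge0 ?mulr_ge0 // ?(ltW delta0) ?(ltW N0) ?(ltW d0).
  (* Near points have F (zeta i) close to F z, distant ones a small weight. *)
  have term i : normc (F (zeta i) - F z) * normc (V i z) <=
      eps / 4 * normc (V i z) + 2 * M * tau.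
    have [close|far] := ltP (normc (zeta i - z)) (2 * d).
      have hF : normc (F (zeta i) - F z) <= eps / 4.
        by apply/ltW/hd3 => //; [exact: rootu_circle | rewrite dE; lra].
      apply: ler_wpDr; first by apply: mulr_ge0 => //; apply: mulr_ge0 => //; exact: ltW.
      by rewrite ler_wpM2r ?normc_ge0.
    apply: ler_wpDl; first by rewrite mulr_ge0 ?normc_ge0 // ltW.
    rewrite ler_pM ?normc_ge0 //.
      have := normcB (F (zeta i)) (F z); have := cM i; have := FM z Tz; lra.
    apply: le_trans (dyadic_log_small (W0 i z z1) J) _.
    rewrite normcBC in far; have := Wfar i z z1 far; rewrite /tau; lra.
  have ptau : p%:R * (2 * M * tau) <= M * T.
    rewrite (_ : _ * _ = M * (8 * N * p%:R / d) * delta); last by rewrite /tau; ring.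
    apply: le_trans (_ : M * (8 * N * p%:R / d) * d1 <= _).
      by rewrite ler_wpM2l // !mulr_ge0 ?divr_ge0 ?mulr_ge0 // ?invr_ge0 ltW.
    rewrite le_eqVlt; apply/orP; left; apply/eqP; rewrite /d1; field.
    by rewrite !gt_eqF.
  have := mix_dist G.[z] (fun i => F (zeta i)) T0 (V0 z z1) (F z).
  rewrite -/(h0 z) -/(A z) => hh.
  have s1 : \sum_(i < p) normc (F (zeta i) - F z) * normc (V i z) <=
      eps / 4 * (A z + 4 * p%:R) + M * T.
    apply: le_trans (_ : \sum_(i < p) (eps / 4 * normc (V i z) + 2 * M * tau) <= _).
      by apply: ler_sum => i _; exact: term.
    rewrite big_split /= sumr_const card_ord -[_ *+ p]mulr_natl lerD //.
    rewrite -mulr_sumr ler_wpM2l ?(ltW e40) // mix_modulus //; [exact: V0 | exact: VI].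
  have s2 : T * normc (G.[z] - F z) <= T * (2 * M).
    rewrite ler_wpM2l ?(ltW T0) //; apply: le_trans (normcB _ _) _.
    by have := GM z z1; have := FM z Tz; lra.
  have Az0 := A0 z z1; have TA : 0 < T + A z by lra.
  have s3 : normc (h0 z - F z) <= eps / 2.
    rewrite -(ler_pM2r TA); apply: le_trans hh _; nra.
  have := hh0 z z1; have := normc_tri (h0 z) h.[z] (F z); lra.
- have AE z : A z = Re (\sum_(i < p) V i z) by rewrite Re_sum.
  pose mu := 3 * p%:R * N * delta.
  have cov : covered (fun z => lam <= A z) (8 * pi * mu / lam).
    apply: covered_avg => //.
    + by move=> z /circleE z1; apply: A0; rewrite z1.
    + move=> e ee; have [dl dl0 hdl] := disc_unif Udisc ee.
      exists dl => // z w Tz Tw zw; rewrite !AE -ReB.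
      by apply: le_lt_trans (Re_normc _) _; exact: hdl.
    + have mu0 : 0 < p%:R * N * delta by rewrite !mulr_gt0.
      have [N1 hN1] := disc_mean Udisc mu0; exists N1 => n hn.
      have -> : avg n A = Re (avg n (fun z => \sum_(i < p) V i z)).
        by rewrite Re_avg; apply: eq_avg => z _; exact: AE.
      apply: le_trans (Re_le_normc _) _.
      have := normc_tri (\sum_(i < p) V i 0) (avg n (fun z => \sum_(i < p) V i z)) 0.
      rewrite !subr0; have := hN1 _ hn.
      suff : normc (\sum_(i < p) V i 0) <= 2 * p%:R * N * delta by rewrite /mu; lra.
      apply: le_trans (normc_sum _ _ _) _.
      apply: le_trans (_ : \sum_(i < p) (2 * (N * delta)) <= _).
        apply: ler_sum => i _; have n01 : normc (0 : R[i]) <= 1 by rewrite normc0.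
        by apply: le_trans (dyadic_log_small (W0 i 0 n01) J) _; rewrite ler_wpM2l.
      by rewrite sumr_const card_ord -[_ *+ p]mulr_natl; lra.
  apply: covered_sub cov.
    move=> z Tz; have z1 : normc z <= 1 by move/circleE: Tz => ->.
    move=> hG; have := mix_dist G.[z] (fun i => F (zeta i)) T0 (V0 z z1) G.[z].
    rewrite -/(h0 z) -/(A z) subrr normc0 mulr0 add0r => hh.
    have s1 : \sum_(i < p) normc (F (zeta i) - G.[z]) * normc (V i z) <= 2 * M * (A z + 4 * p%:R).
      apply: le_trans (_ : \sum_(i < p) (2 * M * normc (V i z)) <= _).
        apply: ler_sum => i _; rewrite ler_wpM2r ?normc_ge0 //.
        have := normcB (F (zeta i)) G.[z]; have := cM i; have := GM z z1; lra.
      rewrite -mulr_sumr ler_wpM2l ?mulr_ge0 ?(ltW M0) // mix_modulus //; [exact: V0 | exact: VI].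
    have Az0 := A0 z z1.
    have s2 : normc (h0 z - G.[z]) * T <= 2 * M * (A z + 4 * p%:R).
      apply: le_trans s1; apply: le_trans hh.
      by rewrite ler_wpM2l ?normc_ge0 // lerDl.
    have kT : M * k * T = M * (4 * p%:R) by rewrite -mulrA kE.
    have s3 : eps / 2 <= normc (h0 z - G.[z]) - 2 * (M * k).
      have := hh0 z z1; have := normc_tri (h0 z) h.[z] G.[z]; lra.
    have s4 : eps / 2 * T <= 2 * M * A z.
      have := ler_wpM2r (ltW T0) s3; rewrite mulrBl; lra.
    have M4 : 0 < 4 * M by lra.
    by rewrite -(ler_pM2r M4) lamE; lra.
  rewrite piE /mu ler_pdivrMr //.
  have -> : 8 * pi' * (3 * p%:R * N * delta) = (24 * pi' * p%:R * N) * delta by ring.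
  apply: le_trans (_ : (24 * pi' * p%:R * N) * d2 <= _).
    by rewrite ler_wpM2l // !mulr_ge0 // ltW.
  by rewrite /d2 mulrC divfK // gt_eqF // !mulr_gt0.
Qed.

End Correction.

(** * Cesaro means over roots of unity *)

Section Fejer.
Context {R : realType}.
Implicit Types (z w : R[i]) (r t : R) (u v : R[i] -> R[i]) (L N k l : nat).

Definition fejer L z : R := normc (\sum_(k < L) z ^+ k) ^+ 2 / L%:R.

Lemma fejer_ge0 L z : 0 <= fejer L z.
Proof. by rewrite divr_ge0 // sqr_ge0. Qed.

Lemma fejer_conj L z : fejer L z^* = fejer L z.
Proof.
rewrite /fejer -[in RHS]normc_conj rmorph_sum /=.
by under [in RHS]eq_bigr do rewrite rmorphXn /=.
Qed.

Lemma fejerE L z w : (fejer L (z * w^*))%:C =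
  L%:R^-1 * \sum_(k < L) \sum_(l < L) (z ^+ k * z^* ^+ l) * (w^* ^+ k * w ^+ l).
Proof.
rewrite /fejer rmorphM /= fmorphV /= rmorph_nat -mul_conjc rmorph_sum /= mulrC; congr (_ * _).
rewrite mulr_suml; apply: eq_bigr => k _; rewrite mulr_sumr; apply: eq_bigr => l _.
have -> : ((z * w^*) ^+ l)^* = z^* ^+ l * w ^+ l.
  by rewrite rmorphXn rmorphM -exprMn; congr ((_ * _) ^+ _); exact: conjcK.
by rewrite !exprMn; ring.
Qed.

Definition fejer_coef N u k l : R[i] := avg N (fun w => u w * (w^* ^+ k * w ^+ l)).

Definition cesaro L N u z : R[i] := avg N (fun w => u w * (fejer L (z * w^*))%:C).

Lemma cesaroE L N u z : cesaro L N u z =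
  L%:R^-1 * \sum_(k < L) \sum_(l < L) (z ^+ k * z^* ^+ l) * fejer_coef N u k l.
Proof.
rewrite /cesaro (@eq_avg _ _ _ _ (fun w => L%:R^-1 * \sum_(k < L) \sum_(l < L)
   (z ^+ k * z^* ^+ l) * (u w * (w^* ^+ k * w ^+ l)))) => [|w _].
  rewrite avgZ avg_sum; congr (_ * _); apply: eq_bigr => k _.
  by rewrite avg_sum; apply: eq_bigr => l _; rewrite avgZ.
rewrite fejerE mulrCA; congr (_ * _); rewrite mulr_sumr; apply: eq_bigr => k _.
by rewrite mulr_sumr; apply: eq_bigr => l _; rewrite mulrCA.
Qed.

(** The kernel is a trigonometric polynomial of degree less than [L], which the
average over N-th roots of unity integrates exactly.  Hence the Cesaro mean
below behaves as for Lebesgue measure. *)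
Lemma fejer_mean L N z : (0 < L)%N -> (L <= N)%N -> unit_circle z ->
  avg N (fun w => fejer L (z * w^*)) = 1.
Proof.
move=> L0 LN Tz; pose one (w : R[i]) : R[i] := 1.
have h : cesaro L N one z = 1.
  rewrite cesaroE (eq_bigr (fun=> 1)) => [|k _].
    by rewrite sumr_const card_ord mulVf // pnatr_eq0 -lt0n.
  have kN : (k < N)%N := leq_trans (ltn_ord k) LN.
  rewrite (bigD1 k) //= big1 ?addr0 => [|l lk]; rewrite /fejer_coef.
    rewrite (@eq_avg _ _ _ _ (fun w => w ^+ k * w^* ^+ k)) => [|w _].
      by rewrite avg_orth // eqxx mulr1 circle_expB // subnn expr0.
    by rewrite mul1r mulrC.
  have lN : (l < N)%N := leq_trans (ltn_ord l) LN.
  rewrite (@eq_avg _ _ _ _ (fun w => w ^+ l * w^* ^+ k)) => [|w _].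
    rewrite avg_orth // (_ : (l == k :> nat) = false) ?mulr0 //.
    by apply/negbTE; apply: contraNneq lk => lk; apply/eqP/val_inj.
  by rewrite mul1r mulrC.
have := congr1 (@complex.Re R) h; rewrite /cesaro Re_avg /= => <-.
by apply: eq_avg => w _ /=; rewrite mul0r subr0 mul1r.
Qed.

Lemma fejer_mean_sym L N w : (0 < L)%N -> (L <= N)%N -> unit_circle w ->
  avg N (fun z => fejer L (z * w^*)) = 1.
Proof.
move=> L0 LN Tw; rewrite -(fejer_mean L0 LN Tw); apply: eq_avg => z _.
by rewrite -fejer_conj rmorphM /= conjcK mulrC.
Qed.

Lemma fejer_far L z w (d : R) : (0 < L)%N -> 0 < d -> unit_circle z -> unit_circle w ->
  d <= normc (w - z) -> fejer L (z * w^*) <= 4 / (L%:R * d ^+ 2).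
Proof.
move=> L0 d0 Tz Tw dw; set v := z * w^*.
have L0' : 0 < L%:R :> R by rewrite ltr0n.
have v1 : normc v = 1.
  by rewrite /v normcM normc_conj; move/circleE: Tz => ->; move/circleE: Tw => ->; rewrite mulr1.
have vd : d <= normc (v - 1).
  have -> : v - 1 = - (w^* * (w - z)).
    by rewrite /v mulrBr [w^* * w]mulrC circle_conj //; ring.
  by rewrite normcN normcM normc_conj; move/circleE: Tw => ->; rewrite mul1r.
have h : normc (v - 1) * normc (\sum_(k < L) v ^+ k) <= 2.
  rewrite -normcM -subrX1; apply: le_trans (normcB _ _) _.
  by rewrite normcX v1 expr1n normc1.
have S0 := normc_ge0 (\sum_(k < L) v ^+ k).
rewrite /fejer ler_pdivrMr //.
have -> : 4 / (L%:R * d ^+ 2) * L%:R = 4 / d ^+ 2 by field; rewrite !gt_eqF.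
rewrite ler_pdivlMr ?exprn_gt0 // -exprMn (_ : 4 = 2 ^+ 2); last by ring.
rewrite lerXn2r ?nnegrE ?mulr_ge0 ?(ltW d0) //.
by apply: le_trans h; rewrite mulrC ler_wpM2r.
Qed.

Lemma normc_cesaro L N u z : normc (cesaro L N u z) <=
  avg N (fun w => normc (u w) * fejer L (z * w^*)).
Proof.
apply: le_trans (normc_avg _ _) _; apply: le_avg => w _.
by rewrite normcM normc_pos // fejer_ge0.
Qed.

Lemma cesaroB L N u v z : cesaro L N (fun w => u w - v w) z = cesaro L N u z - cesaro L N v z.
Proof.
rewrite /cesaro -[- avg _ _]mulN1r -avgZ -avgD; apply: eq_avg => w _.
by ring.
Qed.

Lemma cesaro_bounded L N u z (M : R) : (0 < L)%N -> (L <= N)%N -> unit_circle z ->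
  (forall w, unit_circle w -> normc (u w) <= M) -> normc (cesaro L N u z) <= M.
Proof.
move=> L0 LN Tz uM; apply: le_trans (normc_cesaro _ _ _ _) _.
rewrite -[leRHS]mulr1 -(fejer_mean L0 LN Tz) -avgZ; apply: le_avg => w Tw.
by rewrite ler_wpM2r ?fejer_ge0 ?uM.
Qed.

(** The kernel has mean 1 in each of its two variables, over N'-th roots of unity
as well as over N-th ones.  The freedom of N' lets a polynomial be fixed before
its deviation is measured. *)
Lemma cesaro_contraction L N N' u : (0 < L)%N -> (L <= N')%N ->
  avg N' (fun z => normc (cesaro L N u z)) <= avg N (fun w => normc (u w)).
Proof.
move=> L0 LN'.
apply: le_trans (@le_avg _ _ _ (fun z => avg N (fun w => normc (u w) * fejer L (z * w^*))) _) _.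
  by move=> z _; exact: normc_cesaro.
rewrite avg_exchange; apply: le_avg => w Tw.
by rewrite avgZ fejer_mean_sym // mulr1.
Qed.

Lemma cesaro_close u (M e : R) : 0 < M -> unif_circle u ->
  (forall w, unit_circle w -> normc (u w) <= M) -> 0 < e ->
  exists2 L, (0 < L)%N & forall N z, (L <= N)%N -> unit_circle z ->
    normc (cesaro L N u z - u z) <= e.
Proof.
move=> M0 uu uM e0; have e20 : 0 < e / 2 by lra.
have [d d0 hd] := uu _ e20.
pose L := (Num.bound (16 * M / (e * d ^+ 2))).+1.
have L0 : 0 < L%:R :> R by rewrite ltr0n.
have d20 : 0 < d ^+ 2 by rewrite exprn_gt0.
have hL : 2 * M * (4 / (L%:R * d ^+ 2)) <= e / 2.
  have : 16 * M / (e * d ^+ 2) < L%:R.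
    by apply: lt_trans (unstable.ltr_bound _) _; rewrite ltr_nat.
  rewrite ltr_pdivrMr ?mulr_gt0 // => hL.
  by rewrite mulrA ler_pdivrMr ?mulr_gt0 //; lra.
exists L => // N z LN Tz.
have -> : cesaro L N u z - u z = avg N (fun w => (u w - u z) * (fejer L (z * w^*))%:C).
  have m1 : avg N (fun w => (fejer L (z * w^*))%:C) = 1 :> R[i].
    have -> : avg N (fun w => (fejer L (z * w^*))%:C) = (avg N (fun w => fejer L (z * w^*)))%:C.
      by rewrite /avg rmorphM /= fmorphV /= rmorph_nat rmorph_sum.
    by rewrite fejer_mean.
  rewrite -[u z in LHS]mulr1 -m1 /cesaro -avgZ -[- avg _ _]mulN1r -avgZ -avgD.
  by apply: eq_avg => w _; ring.
apply: le_trans (normc_avg _ _) _.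
apply: le_trans (@le_avg _ _ _ (fun w => e / 2 * fejer L (z * w^*) + e / 2) _) _ => [w Tw|].
  rewrite normcM normc_pos ?fejer_ge0 //.
  have K0 := fejer_ge0 L (z * w^*).
  have [near|far] := ltP (normc (w - z)) d.
    by have := hd _ _ Tw Tz near; nra.
  have K1 := fejer_far (isT : (0 < L)%N) d0 Tz Tw far.
  have uu1 : normc (u w - u z) <= 2 * M.
    by have := normcB (u w) (u z); have := uM _ Tw; have := uM _ Tz; lra.
  apply: ler_wpDl; first by rewrite mulr_ge0 // ltW.
  by apply: le_trans hL; rewrite ler_pM ?normc_ge0.
rewrite avgD avgZ fejer_mean // avg_cst; first lra.
exact: leq_trans LN.
Qed.

Definition analytic_part L N u : {poly R[i]} :=
  L%:R^-1 *: \sum_(k < L) \sum_(l < L | (l <= k)%N) fejer_coef N u k l *: 'X^(k - l).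

Lemma analytic_part_close L N u (kappa : R) z : (0 < L)%N -> unit_circle z ->
  (forall j, (0 < j < L)%N -> normc (avg N (fun w => u w * w ^+ j)) <= kappa) ->
  0 <= kappa ->
  normc (cesaro L N u z - (analytic_part L N u).[z]) <= L%:R * kappa.
Proof.
move=> L0 Tz hk k0; have L0' : 0 < L%:R :> R by rewrite ltr0n.
have -> : cesaro L N u z - (analytic_part L N u).[z] =
  L%:R^-1 * \sum_(k < L) \sum_(l < L | ~~ (l <= k)%N) (z ^+ k * z^* ^+ l) * fejer_coef N u k l.
  rewrite cesaroE hornerZ horner_sum -mulrBr -sumrB; congr (_ * _); apply: eq_bigr => k _.
  rewrite (bigID (fun l : 'I_L => (l <= k)%N)) /= horner_sum addrAC -sumrB.
  rewrite big1 ?add0r // => l lk.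
  by rewrite hornerZ hornerXn circle_expB // mulrC subrr.
rewrite normcM normcV normc_nat mulrC ler_pdivrMr // -mulrA mulrC.
apply: le_trans (normc_sum _ _ _) _.
apply: le_trans (_ : \sum_(k < L) (L%:R * kappa) <= _); last first.
  by rewrite sumr_const card_ord -[_ *+ L]mulr_natr mulrC [L%:R * (kappa * _)]mulrC; lra.
apply: ler_sum => k _; apply: le_trans (normc_sum _ _ _) _.
apply: le_trans (_ : \sum_(l < L) kappa <= _); last first.
  by rewrite sumr_const card_ord -[_ *+ L]mulr_natl.
rewrite big_mkcond; apply: ler_sum => l _; case: ifP => // lk.
rewrite normcM [normc (z ^+ k * _)]normcM !normcX normc_conj; move/circleE: Tz => ->.
rewrite !expr1n !mul1r.
rewrite -ltnNge in lk.
rewrite /fejer_coef (@eq_avg _ _ _ _ (fun w => u w * w ^+ (l - k))) => [|w Tw].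
  by apply: hk; rewrite subn_gt0 lk /= (leq_ltn_trans (leq_subr _ _)).
by rewrite [w^* ^+ k * _]mulrC circle_expB // ltnW.
Qed.

Section Approximation.
Variables (M : R) (F : nat -> R[i] -> R[i]).
Hypotheses (M0 : 0 < M) (Fu : forall n, unif_circle (F n)).
Hypothesis FM : forall n z, unit_circle z -> normc (F n z) <= M.
Hypothesis Fcauchy : forall e : R, 0 < e -> exists n0, forall n m, (n0 <= n)%N -> (n0 <= m)%N ->
  exists N0, forall N, (N0 <= N)%N -> avg N (fun z => normc (F n z - F m z)) <= e.
Hypothesis Fnegative : forall j, (0 < j)%N -> forall e : R, 0 < e ->
  exists n0, forall n, (n0 <= n)%N ->
  exists N0, forall N, (N0 <= N)%N -> normc (avg N (fun z => F n z * z ^+ j)) <= e.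

Lemma Fnegative_uniform L (e : R) : 0 < e -> exists n0, forall n, (n0 <= n)%N ->
  exists N0, forall N, (N0 <= N)%N -> forall j, (0 < j < L)%N ->
    normc (avg N (fun z => F n z * z ^+ j)) <= e.
Proof.
move=> e0; elim: L => [|L [n0 IH]].
  by exists 0%N => n _; exists 0%N => N _ j; rewrite ltn0 andbF.
case: (posnP L) => [->|L0].
  by exists 0%N => n _; exists 0%N => N _ [|j] //.
have [n1 h1] := Fnegative L0 e0; exists (maxn n0 n1) => n; rewrite geq_max => /andP[nn0 nn1].
have [N0 hN0] := IH n nn0; have [N1 hN1] := h1 n nn1.
exists (maxn N0 N1) => N; rewrite geq_max => /andP[NN0 NN1] j /andP[j0].
rewrite ltnS leq_eqVlt => /orP[/eqP ->|jL]; first exact: hN1.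
by apply: hN0; rewrite ?j0.
Qed.

(** The polynomial is taken from [F m] with [m] large depending on [n], since only
then are the finitely many negative coefficients in the Cesaro mean small.  The
smoothing by the Cesaro mean is uniformly harmless on [F n], and it does not
increase the mean distance of [F n] and [F m]. *)
Lemma polynomial_close_off_cover (eps eta : R) : 0 < eps -> 0 < eta ->
  exists n0, forall n, (n0 <= n)%N -> exists2 G : {poly R[i]},
    (forall z, normc z <= 1 -> normc G.[z] <= M) &
    covered (fun z => eps <= normc (F n z - G.[z])) eta.
Proof.
move=> e0 eta0.
have [p p0 pE] : exists2 p : R, 0 < p & pi = p by exists pi; rewrite ?pi_gt0.
pose mu := eta * eps / (8 * p).
have muE : mu * (8 * p) = eta * eps by rewrite divfK // gt_eqF // mulr_gt0.
have mu0 : 0 < mu by rewrite /mu divr_gt0 ?mulr_gt0.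
clearbody mu.
have mu40 : 0 < mu / 4 by lra.
have [n0 hn0] := Fcauchy mu40; exists n0 => n nn0.
have [L L0 hL] := cesaro_close M0 (Fu n) (FM n) mu40.
have L0' : 0 < L%:R :> R by rewrite ltr0n.
(* The analytic part then differs from the Cesaro mean by at most mu / 8. *)
pose kap := mu / (8 * L%:R).
have kap0 : 0 < kap by rewrite divr_gt0 ?mulr_gt0.
have kapE : L%:R * kap = mu / 8 by rewrite /kap; field; rewrite gt_eqF.
have [m0 hm0] := Fnegative_uniform L kap0.
pose m := maxn n0 m0.
have [N1 hN1] := hn0 n m nn0 (leq_maxl _ _).
have [N2 hN2] := hm0 m (leq_maxr _ _).
pose N := maxn L (maxn N1 N2).
have LN : (L <= N)%N by exact: leq_maxl.
have NN1 : (N1 <= N)%N by rewrite /N !leq_max leqnn orbT.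
have NN2 : (N2 <= N)%N by rewrite /N !leq_max leqnn !orbT.
pose G0 := analytic_part L N (F m).
have G0c z : unit_circle z -> normc (cesaro L N (F m) z - G0.[z]) <= mu / 8.
  by move=> Tz; rewrite -kapE; apply: analytic_part_close => //; [exact: hN2 | exact: ltW].
have G0M z : unit_circle z -> normc G0.[z] <= M + mu / 8.
  move=> Tz; have := G0c z Tz; have := cesaro_bounded L0 LN Tz (FM m).
  by have := normc_tri (cesaro L N (F m) z) G0.[z] 0; rewrite !subr0 (normcBC G0.[z]); lra.
(* G0 is bounded by M + mu / 8 on the circle; c scales it back to M. *)
pose c := M / (M + mu / 8).
have Mmu : 0 < M + mu / 8 by have := M0; lra.
have c0 : 0 <= c by rewrite /c divr_ge0 ?(ltW Mmu) ?(ltW M0).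
have cE : c * (M + mu / 8) = M by rewrite divfK // gt_eqF.
have c1 : c <= 1 by rewrite /c ler_pdivrMr // mul1r; lra.
clearbody c.
pose G := c%:C *: G0.
have GM z : unit_circle z -> normc G.[z] <= M.
  move=> Tz; rewrite /G hornerZ normcM normc_pos //.
  by have := ler_wpM2l c0 (G0M z Tz); lra.
have GG0 z : unit_circle z -> normc (G0.[z] - G.[z]) <= mu / 8.
  move=> Tz; have -> : G0.[z] - G.[z] = (1 - c)%:C * G0.[z].
    by rewrite /G (hornerZ c%:C) rmorphB rmorph1 /= mulrBl mul1r.
  have c1' : 0 <= 1 - c by lra.
  rewrite normcM normc_pos //.
  by have := ler_wpM2l c1' (G0M z Tz); lra.
exists G; first exact: poly_maxmod.
have FG z : unit_circle z -> normc (F n z - G.[z]) <=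
    mu / 2 + normc (cesaro L N (fun w => F n w - F m w) z).
  move=> Tz; rewrite cesaroB.
  have e1 := hL N z LN Tz; have e2 := G0c z Tz; have e3 := GG0 z Tz.
  rewrite normcBC in e1.
  have t1 := normc_tri (cesaro L N (F n) z) (F n z) G.[z].
  have t2 := normc_tri (cesaro L N (F m) z) (cesaro L N (F n) z) G.[z].
  have t3 := normc_tri G0.[z] (cesaro L N (F m) z) G.[z].
  lra.
have -> : eta = 8 * pi * mu / eps.
  have -> : 8 * pi * mu = eta * eps by rewrite -muE pE; ring.
  by rewrite mulfK // gt_eqF.
apply: covered_avg => // [z _|e ee|]; first exact: normc_ge0.
  have ee2 : 0 < e / 2 by lra.
  have [d1 d10 hd1] := Fu n ee2.
  have [d2 d20 hd2] := disc_unif (disc_poly G) ee2.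
  exists (Num.min d1 d2); first by rewrite lt_min d10.
  move=> z w Tz Tw; rewrite lt_min => /andP[zw1 zw2].
  have := hd1 z w Tz Tw zw1; have := hd2 z w Tz Tw zw2.
  have tr a b c' d' : normc (a - b : R[i]) <= normc (c' - d') + (normc (a - c') + normc (b - d')).
    have := normc_tri c' a b; have := normc_tri d' c' b.
    by rewrite (normcBC d' b); lra.
  have := tr (F n z) G.[z] (F n w) G.[w]; have := tr (F n w) G.[w] (F n z) G.[z].
  by rewrite (normcBC (F n w) (F n z)) (normcBC G.[w]) => *; rewrite ltr_norml; lra.
exists L => N' LN'.
apply: le_trans (@le_avg _ _ _ (fun z => mu / 2 + normc (cesaro L N (fun w => F n w - F m w) z)) FG) _.
rewrite avgD avg_cst; last exact: leq_trans LN'.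
have := cesaro_contraction N (fun w => F n w - F m w) L0 LN'; have := hN1 _ NN1; lra.
Qed.
End Approximation.
End Fejer.

(** * Averaging polynomials with disjoint bad sets *)

Section Combination.
Context {R : realType}.
Implicit Types (z w : R[i]) (r t : R).
Variables (M : R) (F : nat -> R[i] -> R[i]).
Hypotheses (M0 : 0 < M) (Fu : forall n, unif_circle (F n)).
Hypothesis FM : forall n z, unit_circle z -> normc (F n z) <= M.
Hypothesis Fclose : forall eps eta : R, 0 < eps -> 0 < eta ->
  exists n0, forall n, (n0 <= n)%N -> exists2 G : {poly R[i]},
    (forall z, normc z <= 1 -> normc G.[z] <= M) &
    covered (fun z => eps <= normc (F n z - G.[z])) eta.

Definition bad (eps : R) z (x : nat * {poly R[i]}) := eps < normc (x.2.[z] - F x.1 z).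

(** By induction on the number of polynomials: [F n] comes first, then the
remaining ones with bad sets covered so finely that [F n] can be imitated on
that cover.  The new polynomial is good there, whence disjointness. *)
Lemma disjoint_bad_sets (n0 : nat) (eps : R) m : 0 < eps -> forall eta : R, 0 < eta ->
  exists s : seq (nat * {poly R[i]}), [/\ size s = m,
    forall x, x \in s -> (n0 <= x.1)%N /\ forall z, normc z <= 1 -> normc x.2.[z] <= M,
    forall z, unit_circle z -> (count (bad eps z) s <= 1)%N &
    covered (fun z => has (bad eps z) s) eta].
Proof.
move=> e0; elim: m => [|m IH] eta eta0.
  exists [::]; split => //; exists [::]; split => //.
  by rewrite big_nil ltW.
have e20 : 0 < eps / 2 by lra.
have eta40 : 0 < eta / 4 by lra.
have [n1 hn1] := Fclose e20 eta40.
have [G GM Gcov] := hn1 (maxn n0 n1) (leq_maxr _ _).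
have [delta delta0 hdelta] := polynomial_correction M0 (Fu (maxn n0 n1)) (FM (maxn n0 n1)) GM e20 eta40.
have d0 : 0 < Num.min delta (eta / 2) by rewrite lt_min delta0; lra.
have [s [sm sM sbad [S [S1 S2 S3]]]] := IH _ d0.
have [Sd Se] : \sum_(q <- S) q.2 <= delta /\ \sum_(q <- S) q.2 <= eta / 2.
  by move: S2; rewrite le_min => /andP[].
have [h [hM hK hcov]] := hdelta S S1 Sd.
have hgood z : unit_circle z -> has (bad eps z) s -> bad eps z (maxn n0 n1, h) = false.
  move=> Tz /(S3 z Tz) zS; apply/negbTE; rewrite /bad /= -leNgt.
  by apply: le_trans (hK z Tz zS) _; lra.
exists ((maxn n0 n1, h) :: s); split => /=.
- by rewrite sm.
- by move=> x; rewrite inE => /orP[/eqP ->|/sM //]; split => //=; rewrite leq_maxl.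
- move=> z Tz; have [hs|] := boolP (has (bad eps z) s).
    by rewrite hgood // add0n sbad.
  rewrite has_count -leqNgt leqn0 => /eqP ->; rewrite addn0; exact: leq_b1.
- have covS : covered (fun z => has (bad eps z) s) (eta / 2) by exists S; split.
  apply: covered_sub (coveredU (coveredU hcov Gcov) covS); last by lra.
  move=> z Tz /orP[hb|]; last by right.
  left; have [hG|hG] := leP (eps / 2) (normc (h.[z] - G.[z])); first by left.
  right; have t1 := normc_tri G.[z] h.[z] (F (maxn n0 n1) z).
  rewrite /bad /= in hb; rewrite normcBC; lra.
Qed.

(** Each point is bad for at most one of the [m] polynomials, where the error is at
most [2 * M]. *)
Lemma convex_approximation (n0 : nat) (eps : R) : 0 < eps ->
  exists P : {poly R[i]}, exists s : seq nat,
  [/\ (0 < size s)%N, forall n, n \in s -> (n0 <= n)%N,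
      forall z, normc z <= 1 -> normc P.[z] <= M &
      forall z, unit_circle z ->
        normc (P.[z] - (size s)%:R^-1 * \sum_(n <- s) F n z) <= eps].
Proof.
move=> e0; have e20 : 0 < eps / 2 by lra.
pose m := (Num.bound (4 * M / eps)).+1.
have m0 : 0 < m%:R :> R by rewrite ltr0n.
have hm : 2 * M <= m%:R * (eps / 2).
  have : 4 * M / eps < m%:R by apply: lt_trans (unstable.ltr_bound _) _; rewrite ltr_nat.
  rewrite ltr_pdivrMr //; lra.
have [s [sm sM sbad _]] := disjoint_bad_sets n0 m e20 ltr01.
exists (m%:R^-1 *: \sum_(x <- s) x.2), (map fst s); split.
- by rewrite size_map sm.
- by move=> n /mapP[x /sM[xn _] ->].
- move=> z z1; rewrite hornerZ horner_sum normcM normcV normc_nat mulrC ler_pdivrMr //.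
  apply: le_trans (normc_sum _ _ _) _.
  apply: le_trans (_ : \sum_(x <- s) M <= _).
    rewrite big_seq [leRHS]big_seq; apply: ler_sum => x /sM[_]; exact.
  by rewrite big_const_seq count_predT sm iter_addr_0 mulr_natr.
- move=> z Tz; rewrite size_map sm big_map hornerZ horner_sum -mulrBr -sumrB.
  rewrite normcM normcV normc_nat mulrC ler_pdivrMr //.
  apply: le_trans (normc_sum _ _ _) _.
  apply: le_trans (_ : \sum_(x <- s) (eps / 2 + 2 * M * (bad (eps / 2) z x)%:R) <= _).
    rewrite big_seq [leRHS]big_seq; apply: ler_sum => x xs.
    have M0' := M0; have z1 : normc z <= 1 by move/circleE: Tz => ->.
    rewrite /bad; case: ltP => /= hx.
      have := normcB x.2.[z] (F x.1 z); have := FM x.1 Tz; have [_ /(_ z z1)] := sM x xs.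
      lra.
    by rewrite mulr0 addr0.
  rewrite big_split /= big_const_seq count_predT sm iter_addr_0 -mulr_sumr.
  have -> : \sum_(x <- s) (bad (eps / 2) z x)%:R = (count (bad (eps / 2) z) s)%:R :> R.
    by elim: {sm sM sbad} s => [|x s IH]; rewrite ?big_nil ?big_cons //= IH natrD.
  have := sbad z Tz; rewrite -(ler_nat R) -[_ *+ m]mulr_natl => hc.
  have := ler_wpM2l (ltW M0) hc; lra.
Qed.

Lemma pointwise_approximation (E : set R[i]) (f : R[i] -> R[i]) : E `<=` unit_circle ->
  (forall z, E z -> F n z @[n --> \oo] --> f z) ->
  exists P : nat -> {poly R[i]},
    (forall z, E z -> (P n).[z] @[n --> \oo] --> f z) /\
    (forall n z, unit_disc z -> `|(P n).[z]| <= M%:C).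
Proof.
move=> ET Ff; have inv0 n : 0 < n.+1%:R^-1 :> R by rewrite invr_gt0.
have /choice[P hP] := fun n => convex_approximation n (inv0 n).
exists P; split => [z Ez|n z]; last first.
  rewrite /unit_disc /= -[1]/(1%:C) norm_ltC norm_leC => /ltW z1.
  by have [s [_ _ + _]] := hP n; apply.
apply/cvg_seqP => e e0; have e20 : 0 < e / 2 by lra.
have /cvg_seqP/(_ _ e20)[N hN] := Ff z Ez.
exists (maxn N (Num.bound (2 / e))) => n; rewrite geq_max => /andP[Nn en].
have [s [s0 sn _ hs]] := hP n.
have s0' : 0 < (size s)%:R :> R by rewrite ltr0n.
have h1 : n.+1%:R^-1 < e / 2.
  have -> : e / 2 = (2 / e)^-1 by field; rewrite gt_eqF.
  rewrite ltf_pV2 ?posrE ?divr_gt0 //.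
  by apply: lt_trans (unstable.ltr_bound _) _; rewrite ltr_nat ltnS.
have h2 : normc ((size s)%:R^-1 * \sum_(n <- s) F n z - f z) <= e / 2.
  have -> : f z = (size s)%:R^-1 * \sum_(n <- s) f z.
    rewrite big_const_seq count_predT iter_addr_0 -[f z *+ _]mulr_natl mulKf //.
    by rewrite pnatr_eq0 -lt0n.
  rewrite -mulrBr -sumrB normcM normcV normc_nat mulrC ler_pdivrMr //.
  apply: le_trans (normc_sum _ _ _) _.
  apply: le_trans (_ : \sum_(n <- s) (e / 2) <= _).
    rewrite big_seq [leRHS]big_seq; apply: ler_sum => k /sn nk.
    by apply: ltW; apply: hN; apply: leq_trans nk.
  by rewrite big_const_seq count_predT iter_addr_0 mulr_natr.
have h3 := hs z (ET z Ez).
apply: le_lt_trans (normc_tri ((size s)%:R^-1 * \sum_(n <- s) F n z) _ _) _.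
by rewrite (splitr e) ltr_leD // (le_lt_trans h3).
Qed.

End Combination.

(** * Integrals of continuous functions and their Riemann sums *)

Section Integral.
Context {R : realType}.
Implicit Types (u v : R -> R) (a b c t : R).
Local Notation mu := (@lebesgue_measure R).

Definition itg u a b : R := \int[mu]_(x in `[a, b]) u x.

Lemma itg_integrable u a b : continuous u -> mu.-integrable `[a, b] (EFin \o u).
Proof.
move=> cu; apply: continuous_compact_integrable; first exact: segment_compact.
exact: continuous_subspaceT.
Qed.

Lemma itgD u v a b : continuous u -> continuous v ->
  itg (fun x => u x + v x) a b = itg u a b + itg v a b.
Proof. by move=> cu cv; rewrite /itg RintegralD //; exact: itg_integrable. Qed.

Lemma itgZ k u a b : continuous u -> itg (fun x => k * u x) a b = k * itg u a b.
Proof. by move=> cu; rewrite /itg RintegralZl //; exact: itg_integrable. Qed.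

Lemma itg_cst k a b : a <= b -> itg (fun=> k) a b = k * (b - a).
Proof.
rewrite le_eqVlt => /orP[/eqP <-|ab].
  by rewrite subrr mulr0 /itg set_itv1 Rintegral_set1.
by rewrite /itg Rintegral_cst //= lebesgue_measure_itv /= lte_fin ab.
Qed.

Lemma le_itg u v a b : continuous u -> continuous v ->
  (forall x, a <= x <= b -> u x <= v x) -> itg u a b <= itg v a b.
Proof.
move=> cu cv uv; apply: le_Rintegral => //; try exact: itg_integrable.
Qed.

Lemma itg_split u a b c : continuous u -> a <= b -> b <= c ->
  itg u a c = itg u a b + itg u b c.
Proof.
move=> cu ab bc; have iu := itg_integrable a c cu.
have := Rintegral_itvB iu (x := b); rewrite !bnd_simp => /(_ ab bc).
rewrite Rintegral_itv_obnd_cbnd; last first.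
  by apply: integrableS iu => //; apply: subset_itvr; rewrite bnd_simp.
by rewrite /itg => <-; rewrite addrC subrK.
Qed.

Lemma itg_abs u a b K : a <= b -> continuous u ->
  (forall x, a <= x <= b -> `|u x| <= K) -> `|itg u a b| <= K * (b - a).
Proof.
move=> ab cu uK; have cK (k : R) : continuous (fun _ : R => k) by exact: cst_continuous.
rewrite ler_norml -mulNr -!itg_cst // !le_itg // => x /uK; rewrite ler_norml => /andP[] //.
Qed.

Lemma itg_FTC (U u : R -> R) a b : a <= b -> continuous u ->
  (forall x : R, is_derive x (1 : R) U (u x)) -> itg u a b = U b - U a.
Proof.
rewrite le_eqVlt => /orP[/eqP <-|ab] cu dU.
  by rewrite subrr /itg set_itv1 Rintegral_set1.
have cU : continuous U.
  by move=> x; apply: differentiable_continuous; apply/derivable1_diffP; case: (dU x).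
rewrite /itg /Rintegral (@continuous_FTC2 _ u U) //.
- exact: continuous_subspaceT.
- split => [x _||]; first by case: (dU x).
    exact/cvg_at_right_filter/cU.
  exact/cvg_at_left_filter/cU.
- by move=> x _; rewrite derive1E; case: (dU x).
Qed.

Lemma unif_cont_itv u a b (e : R) : continuous u -> 0 < e ->
  exists2 d : R, 0 < d & forall s t, a <= s <= b -> a <= t <= b ->
    `|s - t| < d -> `|u s - u t| < e.
Proof.
move=> cu e0; have e20 : 0 < e / 2 by lra.
have /compact_near_coveringP ncov := @segment_compact R a b.
pose P (d : R) s := a <= s <= b -> forall t, a <= t <= b -> `|s - t| < d -> `|u s - u t| < e.
have : \forall d \near 0^'+, forall s, s \in `[a, b] -> P d s.
  apply: ncov => s _.
  have /cvgrPdist_lt/(_ _ e20)/nbhs_ballP[d /= d0 hd] := cu s.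
  have d20 : 0 < d / 2 by lra.
  near=> s' dd; rewrite /P /= => s'ab t tab s't.
  have ss' : `|s - s'| < d / 2 by near: s'; exact: nbhsx_ballx.
  have ddd : dd < d / 2 by near: dd; exact: nbhs_right_lt.
  have h1 : `|u s - u s'| < e / 2 by apply: hd; rewrite /ball /=; lra.
  have h2 : `|u s - u t| < e / 2.
    apply: hd; rewrite /ball /=.
    by have := ler_distD s' s t; lra.
  by have := ler_distD (u s) (u s') (u t); rewrite (distrC (u s') (u s)); lra.
move=> [d /= d0 hd]; exists (d / 2); first by rewrite divr_gt0.
move=> s t sab tab st; apply: (hd (d / 2)) => //=.
- by rewrite sub0r normrN ger0_norm; lra.
- by lra.
Unshelve. all: by end_near.
Qed.

Lemma itg_sum u (n : nat) (x : nat -> R) : continuous u ->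
  (forall i, x i <= x i.+1) ->
  itg u (x 0%N) (x n) = \sum_(j < n) itg u (x j) (x j.+1).
Proof.
move=> cu xS; elim: n => [|n IH].
  by rewrite big_ord0 /itg set_itv1 Rintegral_set1.
rewrite big_ord_recr /= -IH; apply: itg_split => //.
elim: n {IH} => // n; move=> h; exact: le_trans h _.
Qed.

Lemma riemann_sum u (e : R) : continuous u -> 0 < e ->
  exists N0, forall N, (N0 <= N)%N ->
    `|N%:R^-1 * \sum_(j < N) u (2 * pi * j%:R / N%:R) - (2 * pi)^-1 * itg u 0 (2 * pi)| <= e.
Proof.
move=> cu e0.
have [p p0 pE] : exists2 p : R, 0 < p & 2 * pi = p.
  by exists (2 * pi) => //; rewrite mulr_gt0 // pi_gt0.
rewrite pE.
have [d d0 hd] := @unif_cont_itv u 0 p e cu e0.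
exists (Num.bound (p / d)).+1 => N hN.
have N0 : (0 < N)%N by apply: leq_trans hN.
have N0' : 0 < N%:R :> R by rewrite ltr0n.
have pN : p / N%:R < d.
  rewrite ltr_pdivrMr // [d * _]mulrC -ltr_pdivrMr //.
  by apply: lt_le_trans (unstable.ltr_bound _) _; rewrite ler_nat ltnW.
pose x (j : nat) := p * j%:R / N%:R.
have xS j : x j.+1 - x j = p / N%:R by rewrite /x -natr1; ring.
have pN0 : 0 < p / N%:R by rewrite divr_gt0.
have xle j : x j <= x j.+1 by have := xS j; lra.
have x0 : x 0%N = 0 by rewrite /x mulr0 mul0r.
have xN : x N = p by rewrite /x mulfK // gt_eqF.
have -> : itg u 0 p = \sum_(j < N) itg u (x j) (x j.+1) by rewrite -{1}x0 -{1}xN itg_sum.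
have xb j : (j <= N)%N -> 0 <= x j <= p.
  move=> jN; rewrite /x divr_ge0 ?mulr_ge0 ?(ltW p0) //=.
  by rewrite ler_pdivrMr // ler_pM2l // ler_nat.
have cell (j : 'I_N) : `|p / N%:R * u (x j) - itg u (x j) (x j.+1)| <= e * (p / N%:R).
  have -> : p / N%:R * u (x j) - itg u (x j) (x j.+1) =
      - itg (fun t => u t + - u (x j)) (x j) (x j.+1).
    rewrite itgD //; last by exact: cst_continuous.
    by rewrite itg_cst // xS; ring.
  rewrite normrN -(xS j); apply: itg_abs => //.
    by move=> t; apply: cvgD; [exact: cu | exact: cvg_cst].
  move=> t tj; apply/ltW/hd.
  - have := xb j (ltnW (ltn_ord j)); have := xb j.+1 (ltn_ord j); lra.
  - exact: xb (ltnW (ltn_ord j)).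
  - by rewrite ger0_norm; have := xS j; lra.
have -> : N%:R^-1 * \sum_(j < N) u (p * j%:R / N%:R) - p^-1 * \sum_(j < N) itg u (x j) (x j.+1) =
    p^-1 * \sum_(j < N) (p / N%:R * u (x j) - itg u (x j) (x j.+1)).
  rewrite sumrB mulrBr -mulr_sumr; congr (_ - _); rewrite mulrA; congr (_ * _).
  by field; rewrite !gt_eqF.
rewrite normrM ger0_norm ?invr_ge0 ?(ltW p0) // ler_pdivrMl //.
apply: le_trans (ler_norm_sum _ _ _) _.
apply: le_trans (_ : \sum_(j < N) (e * (p / N%:R)) <= _); first by apply: ler_sum.
rewrite sumr_const card_ord -[_ *+ N]mulr_natr le_eqVlt; apply/orP; left; apply/eqP.
by field; rewrite gt_eqF.
Qed.

(** Lebesgue's theorem; the end point [2 * pi] is a null set. *)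
Lemma itg_dominated (u : nat -> R -> R) (B : R) :
  (forall n, continuous (u n)) -> (forall n t, 0 <= u n t <= B) ->
  {ae mu, forall t, 0 <= t < 2 * pi -> u n t @[n --> \oo] --> (0 : R)} ->
  itg (u n) 0 (2 * pi) @[n --> \oo] --> (0 : R).
Proof.
move=> cu uB u0.
have cB : continuous (fun _ : R => B) by exact: cst_continuous.
have mD : measurable (`[0, 2 * pi]%classic : set R) by [].
have := @dominated_convergence _ _ R mu `[0, 2 * pi]%classic mD
  (fun n => EFin \o u n) (cst 0%E) (fun=> B%:E).
move=> [].
- by move=> n; apply: (measurable_int mu); exact: itg_integrable.
- exact: measurable_cst.
- have z2 : {ae mu, forall t : R, t != 2 * pi}.
    exists [set 2 * pi]; split => //.
      by rewrite lebesgue_measure_set1.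
    by move=> t /= h; apply: contrapT => /eqP h2; apply: h.
  apply: (@filterS2 _ _ (ae_filter_ringOfSetsType mu) _ _ _ _ u0 z2) => t ht tp /=; rewrite in_itv /= => /andP[t0 t1].
  apply: cvg_EFin; first by near=> n.
  apply: ht; rewrite t0 lt_neqAle tp //.
- exact: (itg_integrable 0 (2 * pi) cB).
- apply: aeW => t n _ /=; rewrite lee_fin ger0_norm; by case/andP: (uB n t).
move=> _ _; rewrite integral0 => /fine_cvg.
exact.
Unshelve. all: by end_near.
Qed.

End Integral.

(** * Complex-valued integrals *)

Section ComplexIntegral.
Context {R : realType}.
Implicit Types (p q : R -> R[i]) (z w c : R[i]) (a b s t : R).

(** Continuity of both components is the form in which real integrals use it. *)
Definition rcont q := continuous (fun t => Re (q t)) /\ continuous (fun t => Im (q t)).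

Definition econt q := forall t (e : R), 0 < e -> exists2 d : R, 0 < d &
  forall s, `|s - t| < d -> normc (q s - q t) < e.

Lemma econt_rcont q : econt q -> rcont q.
Proof.
move=> h; split=> t; apply/cvgrPdist_lt => e e0; have [d d0 hd] := h t e e0.
- apply/nbhs_ballP; exists d => //= s; rewrite /ball /= distrC => /hd.
  by apply: le_lt_trans; rewrite distrC -ReB; exact: Re_normc.
- apply/nbhs_ballP; exists d => //= s; rewrite /ball /= distrC => /hd.
  by apply: le_lt_trans; rewrite distrC -ImB; exact: Im_normc.
Qed.

Lemma rcont_const c : rcont (fun=> c).
Proof. by split; exact: cst_continuous. Qed.

Lemma rcontD p q : rcont p -> rcont q -> rcont (fun t => p t + q t).
Proof.
move=> [p1 p2] [q1 q2]; split.
  have -> : (fun t => Re (p t + q t)) = (fun t => Re (p t) + Re (q t)).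
    by apply/funext => t; rewrite ReD.
  by move=> t; apply: cvgD; [exact: p1|exact: q1].
have -> : (fun t => Im (p t + q t)) = (fun t => Im (p t) + Im (q t)).
  by apply/funext => t; rewrite ImD.
by move=> t; apply: cvgD; [exact: p2|exact: q2].
Qed.

Lemma ReM z w : Re (z * w) = Re z * Re w - Im z * Im w.
Proof. by case: z => ? ?; case: w. Qed.

Lemma ImM z w : Im (z * w) = Re z * Im w + Im z * Re w.
Proof. by case: z => ? ?; case: w. Qed.

Lemma rcontM p q : rcont p -> rcont q -> rcont (fun t => p t * q t).
Proof.
move=> [p1 p2] [q1 q2]; split.
  have -> : (fun t => Re (p t * q t)) = (fun t => Re (p t) * Re (q t) - Im (p t) * Im (q t)).
    by apply/funext => t; rewrite ReM.
  by move=> t; apply: cvgB; apply: cvgM; [exact: p1|exact: q1|exact: p2|exact: q2].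
have -> : (fun t => Im (p t * q t)) = (fun t => Re (p t) * Im (q t) + Im (p t) * Re (q t)).
  by apply/funext => t; rewrite ImM.
by move=> t; apply: cvgD; apply: cvgM; [exact: p1|exact: q2|exact: p2|exact: q1].
Qed.

Lemma rcontN p : rcont p -> rcont (fun t => - p t).
Proof.
have -> : (fun t => - p t) = (fun t => (-1) * p t) by apply/funext => t; rewrite mulN1r.
by apply: rcontM; exact: rcont_const.
Qed.

Lemma rcontB p q : rcont p -> rcont q -> rcont (fun t => p t - q t).
Proof. by move=> hp /rcontN; exact: rcontD. Qed.

Lemma rcont_cis : rcont cis.
Proof. by split; [exact: continuous_cos | exact: continuous_sin]. Qed.

Lemma rcont_real : rcont (real_complex R).
Proof. by split; [move=> t; exact: cvg_id | exact: cst_continuous]. Qed.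

Definition cint q a b : R[i] := itg (fun t => Re (q t)) a b +i* itg (fun t => Im (q t)) a b.

Lemma eq_complexP z w : Re z = Re w -> Im z = Im w -> z = w.
Proof. by case: z w => a b [c d] /= -> ->. Qed.

Lemma cintD p q a b : rcont p -> rcont q ->
  cint (fun t => p t + q t) a b = cint p a b + cint q a b.
Proof.
move=> [p1 p2] [q1 q2]; apply: eq_complexP; rewrite ?ReD ?ImD /= -itgD //;
  by congr itg; apply/funext => t; rewrite ?ReD ?ImD.
Qed.

Lemma cintZ c q a b : rcont q -> cint (fun t => c * q t) a b = c * cint q a b.
Proof.
move=> [q1 q2].
have cZ (k : R) (u : R -> R) : continuous u -> continuous (fun t => k * u t).
  by move=> cu t; apply: cvgM; [exact: cvg_cst | exact: cu].
apply: eq_complexP; rewrite ?ReM ?ImM /= -!itgZ //.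
  rewrite -mulN1r -itgZ; last exact: cZ.
  rewrite -itgD; [| exact: cZ | exact/cZ/cZ].
  by congr itg; apply/funext => t; rewrite ReM mulN1r.
rewrite -itgD; [| exact: cZ | exact: cZ].
by congr itg; apply/funext => t; rewrite ImM.
Qed.

Lemma cint_cst c a b : a <= b -> cint (fun=> c) a b = c * (b - a)%:C.
Proof.
move=> ab; rewrite /cint !itg_cst //.
by apply: eq_complexP; rewrite ?ReM ?ImM /=; ring.
Qed.

Lemma cint_split q a b t : rcont q -> a <= t -> t <= b ->
  cint q a b = cint q a t + cint q t b.
Proof.
move=> [q1 q2] at_ tb; apply: eq_complexP; rewrite ?ReD ?ImD /=; exact: itg_split.
Qed.

Lemma cint_bound q a b K : rcont q -> a <= b -> (forall t, a <= t <= b -> normc (q t) <= K) ->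
  normc (cint q a b) <= 2 * K * (b - a).
Proof.
move=> [q1 q2] ab qK; apply: le_trans (normc_ReIm _) _ => /=.
rewrite -mulrA mulr_natl mulr2n lerD //; apply: itg_abs => // t /qK; apply: le_trans.
  exact: Re_normc.
exact: Im_normc.
Qed.

Lemma cint_cis a b : a <= b -> cint (fun t => 'i * cis t) a b = cis b - cis a.
Proof.
move=> ab; apply: eq_complexP; rewrite /= ?ReB ?ImB /=.
  rewrite -(@itg_FTC _ cos (fun x => - sin x)) //.
    by congr itg; apply/funext => t /=; rewrite mul0r mul1r sub0r.
  by move=> t; apply: cvgN; exact: continuous_sin.
rewrite -(@itg_FTC _ sin cos) //; last exact: continuous_cos.
by congr itg; apply/funext => t /=; rewrite mul0r mul1r add0r.
Qed.

Lemma is_derive_cos2 (t : R) : is_derive t (1 : R)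
  (fun t : R => (cos t * cos t - sin t * sin t) / 2) (- (2 * sin t * cos t)).
Proof. by apply: is_derive_eq; rewrite -![_ *: _]/(_ * _); field. Qed.

Lemma is_derive_sincos (t : R) : is_derive t (1 : R)
  (fun t : R => sin t * cos t) (cos t * cos t - sin t * sin t).
Proof. by apply: is_derive_eq; rewrite -![_ *: _]/(_ * _); ring. Qed.

Lemma is_derive_half_sqr (t : R) : is_derive t (1 : R) (fun t : R => t * t / 2) t.
Proof. by apply: is_derive_eq; rewrite -![_ *: _]/(_ * _); field. Qed.

Lemma cint_cis2 a b : a <= b ->
  cint (fun t => 'i * cis t * cis t) a b = (cis b ^+ 2 - cis a ^+ 2) / 2.
Proof.
move=> ab.
have h2 : (2^-1 : R[i]) = (2^-1 : R)%:C by rewrite fmorphV rmorph_nat.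
have c1 : continuous (fun t : R => - (2 * sin t * cos t)).
  move=> t; apply: cvgN; apply: cvgM; last exact: continuous_cos.
  by apply: cvgM; [exact: cvg_cst | exact: continuous_sin].
have c2 : continuous (fun t : R => cos t * cos t - sin t * sin t).
  by move=> t; apply: cvgB; apply: cvgM; first [exact: continuous_cos | exact: continuous_sin].
rewrite h2; apply: eq_complexP; rewrite !expr2 /=.
  transitivity (itg (fun t : R => - (2 * sin t * cos t)) a b).
    by congr itg; apply/funext => t /=; ring.
  by rewrite (itg_FTC ab c1 is_derive_cos2); ring.
transitivity (itg (fun t : R => cos t * cos t - sin t * sin t) a b).
  by congr itg; apply/funext => t /=; ring.
by rewrite (itg_FTC ab c2 is_derive_sincos); field.
Qed.

Lemma cint_id a b : a <= b -> cint (real_complex R) a b = ((b ^+ 2 - a ^+ 2) / 2)%:C.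
Proof.
move=> ab; apply: eq_complexP => /=; last by rewrite itg_cst // mul0r.
have c1 : continuous (fun t : R => t) by move=> t; exact: cvg_id.
by rewrite (itg_FTC ab c1 is_derive_half_sqr) !expr2; ring.
Qed.

End ComplexIntegral.

(** * Goursat's bisection argument *)

Section Bisection.
Context {R : realType}.
Implicit Types (a b x y : R).

(** The limit is the supremum of the left end points. *)
Lemma nested_limit (l w : nat -> R) : (forall n, 0 <= w n) ->
  (forall n, l n <= l n.+1) -> (forall n, l n.+1 + w n.+1 <= l n + w n) ->
  exists x, forall n, l n <= x <= l n + w n.
Proof.
move=> w0 lS uS.
have lmono n m : (n <= m)%N -> l n <= l m.
  by elim: m => [|m IH]; [rewrite leqn0 => /eqP -> | rewrite leq_eqVlt => /orP[/eqP -> //|/IH h]; exact: le_trans h _].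
have umono n m : (n <= m)%N -> l m + w m <= l n + w n.
  by elim: m => [|m IH]; [rewrite leqn0 => /eqP -> | rewrite leq_eqVlt => /orP[/eqP -> //|/IH]; exact: le_trans].
have lu n m : l n <= l m + w m.
  have [nm|/ltnW mn] := leqP n m.
    by apply: le_trans (lmono _ _ nm) _; rewrite lerDl.
  by apply: le_trans (umono _ _ mn); rewrite lerDl.
have hs : has_sup (range l).
  by split; [exists (l 0%N); exists 0%N | exists (l 0%N + w 0%N) => _ [n _ <-]].
exists (sup (range l)) => n; apply/andP; split.
  by apply: sup_ubound; [case: hs | exists n].
by apply: ge_sup; [exists (l 0%N); exists 0%N | move=> _ [m _ <-]].
Qed.

Variables (J : R -> R -> R -> R -> R[i]) (a b : R).
Hypotheses (a0 : 0 <= a) (b0 : 0 <= b).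
Hypothesis Jx : forall x0 x1 x2 y0 y1, x0 <= x1 -> x1 <= x2 -> y0 <= y1 ->
  J x0 x2 y0 y1 = J x0 x1 y0 y1 + J x1 x2 y0 y1.
Hypothesis Jy : forall x0 x1 y0 y1 y2, x0 <= x1 -> y0 <= y1 -> y1 <= y2 ->
  J x0 x1 y0 y2 = J x0 x1 y0 y1 + J x0 x1 y1 y2.
Hypothesis Jloc : forall x y, 0 <= x <= a -> 0 <= y <= b -> forall e : R, 0 < e ->
  exists2 d : R, 0 < d & forall x0 x1 y0 y1, 0 <= x0 <= x -> x <= x1 <= a ->
    0 <= y0 <= y -> y <= y1 <= b -> x1 - x0 < d -> y1 - y0 < d ->
    normc (J x0 x1 y0 y1) <= e * ((x1 - x0) + (y1 - y0)) ^+ 2.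

(** The rectangle with lower left corner [q] at the n-th stage of the bisection. *)
Let cell n (q : R * R) := J q.1 (q.1 + a / 2 ^+ n) q.2 (q.2 + b / 2 ^+ n).

Let half c n : c / 2 ^+ n = c / 2 ^+ n.+1 + c / 2 ^+ n.+1 :> R.
Proof. by rewrite exprS; field; rewrite expf_neq0. Qed.

Let cell_quarter (nq : nat * (R * R)) : exists q' : R * R,
  [/\ nq.2.1 <= q'.1, q'.1 + a / 2 ^+ nq.1.+1 <= nq.2.1 + a / 2 ^+ nq.1,
      nq.2.2 <= q'.2, q'.2 + b / 2 ^+ nq.1.+1 <= nq.2.2 + b / 2 ^+ nq.1 &
      normc (cell nq.1 nq.2) <= 4 * normc (cell nq.1.+1 q')].
Proof.
case: nq => n [x y] /=; pose da := a / 2 ^+ n.+1; pose db := b / 2 ^+ n.+1.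
have da0 : 0 <= da by rewrite divr_ge0 // exprn_ge0.
have db0 : 0 <= db by rewrite divr_ge0 // exprn_ge0.
have E : cell n (x, y) = cell n.+1 (x, y) + cell n.+1 (x, y + db) +
   (cell n.+1 (x + da, y) + cell n.+1 (x + da, y + db)).
  rewrite /cell /= (half a n) (half b n) -/da -/db !addrA.
  have x1 : x <= x + da by rewrite lerDl.
  have x2 : x + da <= x + da + da by rewrite lerDl.
  have y1 : y <= y + db by rewrite lerDl.
  have y2 : y + db <= y + db + db by rewrite lerDl.
  rewrite (Jx x1 x2 (le_trans y1 y2)).
  by rewrite (Jy x1 y1 y2) (Jy x2 y1 y2) !addrA.
have [h|h1] := leP (normc (cell n (x, y))) (4 * normc (cell n.+1 (x, y))).
  by exists (x, y); split; rewrite //= (half a n, half b n) -/da -/db; lra.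
have [h|h2] := leP (normc (cell n (x, y))) (4 * normc (cell n.+1 (x, y + db))).
  by exists (x, y + db); split; rewrite //= ?(half a n) ?(half b n) -/da -/db; lra.
have [h|h3] := leP (normc (cell n (x, y))) (4 * normc (cell n.+1 (x + da, y))).
  by exists (x + da, y); split; rewrite //= ?(half a n) ?(half b n) -/da -/db; lra.
have [h|h4] := leP (normc (cell n (x, y))) (4 * normc (cell n.+1 (x + da, y + db))).
  by exists (x + da, y + db); split; rewrite //= ?(half a n) ?(half b n) -/da -/db; lra.
have := normcD (cell n.+1 (x, y) + cell n.+1 (x, y + db))
  (cell n.+1 (x + da, y) + cell n.+1 (x + da, y + db)).
have := normcD (cell n.+1 (x, y)) (cell n.+1 (x, y + db)).
have := normcD (cell n.+1 (x + da, y)) (cell n.+1 (x + da, y + db)).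
rewrite -E; lra.
Qed.

(** If [J 0 a 0 b] were not 0, one of the four quarters of the rectangle would carry
at least a quarter of it, and so on.  At the common point of the nested rectangles
this contradicts [Jloc], as areas are divided by four as well. *)
Lemma bisection : J 0 a 0 b = 0.
Proof.
have [f hf] := choice cell_quarter.
pose s := fix s n := if n is m.+1 then f (m, s m) else (0, 0) : R * R.
have hs n := hf (n, s n).
have w0 c n : 0 <= c -> 0 <= c / 2 ^+ n :> R by move=> c0; rewrite divr_ge0 // exprn_ge0.
have [x hx] : exists x, forall n, (s n).1 <= x <= (s n).1 + a / 2 ^+ n.
  by apply: nested_limit => n; [exact: w0 | case: (hs n) | case: (hs n)].
have [y hy] : exists y, forall n, (s n).2 <= y <= (s n).2 + b / 2 ^+ n.
  by apply: nested_limit => n; [exact: w0 | case: (hs n) | case: (hs n)].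
have bnd n : [/\ 0 <= (s n).1, (s n).1 + a / 2 ^+ n <= a, 0 <= (s n).2 & (s n).2 + b / 2 ^+ n <= b].
  elim: n => [|n [i1 i2 i3 i4]]; first by rewrite /= !add0r expr0 !divr1.
  by have [j1 j2 j3 j4 _] := hs n; split; [exact: le_trans j1 | exact: le_trans i2 | exact: le_trans j3 | exact: le_trans i4].
have big n : normc (J 0 a 0 b) <= 4 ^+ n * normc (cell n (s n)).
  elim: n => [|n IH]; first by rewrite /cell /= expr0 mul1r !add0r expr0 !divr1.
  apply: le_trans IH _; rewrite exprSr -mulrA ler_wpM2l ?exprn_ge0 //.
  by case: (hs n).
apply: eq0_normc; apply/eqP; rewrite eq_le normc_ge0 andbT leNgt; apply/negP => t0.
set t := normc (J 0 a 0 b) in t0 *.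
have C0 : 0 < (a + b) ^+ 2 + 1 by have := sqr_ge0 (a + b); lra.
have e0 : 0 < t / ((a + b) ^+ 2 + 1) by rewrite divr_gt0.
have xa : 0 <= x <= a by have := hx 0%N; rewrite /= add0r expr0 divr1.
have yb : 0 <= y <= b by have := hy 0%N; rewrite /= add0r expr0 divr1.
have [d d0 hd] := Jloc xa yb e0.
have [n hn] := @exprn_unbounded R 2 ((a + b) / d) (ltr1n R 2).
have p0 : 0 < 2 ^+ n :> R by rewrite exprn_gt0.
have abn : a / 2 ^+ n + b / 2 ^+ n < d.
  by rewrite -mulrDl ltr_pdivrMr // mulrC -ltr_pdivrMr.
have [i1 i2 i3 i4] := bnd n; have := hx n; have := hy n => /andP[y1 y2] /andP[x1 x2].
have an0 := w0 a n a0; have bn0 := w0 b n b0.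
have := hd (s n).1 ((s n).1 + a / 2 ^+ n) (s n).2 ((s n).2 + b / 2 ^+ n).
have subE (u v : R) : u + v - u = v by ring.
rewrite i1 x1 x2 i2 i3 y1 y2 i4 !subE => /(_ isT isT isT isT) hJ.
have {hJ} hJ : normc (cell n (s n)) <= t / ((a + b) ^+ 2 + 1) * (a / 2 ^+ n + b / 2 ^+ n) ^+ 2.
  by apply: hJ; lra.
have tb : t <= t / ((a + b) ^+ 2 + 1) * (a + b) ^+ 2.
  apply: le_trans (big n) _.
  have -> : t / ((a + b) ^+ 2 + 1) * (a + b) ^+ 2 =
      4 ^+ n * (t / ((a + b) ^+ 2 + 1) * (a / 2 ^+ n + b / 2 ^+ n) ^+ 2).
    have -> : 4 ^+ n = (2 ^+ n) ^+ 2 :> R by rewrite exprAC; congr (_ ^+ _); ring.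
    by field; rewrite !gt_eqF.
  by rewrite ler_wpM2l // exprn_ge0.
have : t / ((a + b) ^+ 2 + 1) * (a + b) ^+ 2 < t.
  by rewrite mulrAC ltr_pdivrMr // ltr_pM2l //; lra.
by rewrite ltNge tb.
Qed.

End Bisection.

(** * Contour integrals around polar rectangles *)

Section PolarContour.
Context {R : realType}.
Implicit Types (p q : R -> R -> R[i]) (z w c : R[i]) (r s t x y : R).

Definition pcont p := (forall x, rcont (p x)) /\ (forall y, rcont (p ^~ y)).

(** The integral of [h z dz] around the polar rectangle with radii in [[x0, x1]] and
angles in [[y0, y1]], where [p x y] is the value of [h] at the point of polar
coordinates [x] and [y]. *)
Definition contour p x0 x1 y0 y1 : R[i] :=
  cint (fun t => 'i * cis t * (x1%:C * p x1 t - x0%:C * p x0 t)) y0 y1 -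
  cint (fun s => cis y1 * p s y1 - cis y0 * p s y0) x0 x1.

Lemma rcont_angular p c x0 x1 : pcont p ->
  rcont (fun t => c * cis t * (x1%:C * p x1 t - x0%:C * p x0 t)).
Proof.
move=> [p1 p2]; apply: rcontM; first by apply: rcontM; [exact: rcont_const | exact: rcont_cis].
by apply: rcontB; apply: rcontM => //; exact: rcont_const.
Qed.

Lemma rcont_radial p c0 c1 y0 y1 : pcont p -> rcont (fun s => c1 * p s y1 - c0 * p s y0).
Proof.
move=> [p1 p2]; apply: rcontB; apply: rcontM; first [exact: rcont_const | exact: p2].
Qed.

Lemma contour_split_radius p x0 x1 x2 y0 y1 : pcont p -> x0 <= x1 -> x1 <= x2 ->
  contour p x0 x2 y0 y1 = contour p x0 x1 y0 y1 + contour p x1 x2 y0 y1.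
Proof.
move=> cp x01 x12; rewrite /contour (cint_split (rcont_radial _ _ _ _ cp) x01 x12).
have -> : cint (fun t => 'i * cis t * (x2%:C * p x2 t - x0%:C * p x0 t)) y0 y1 =
   cint (fun t => 'i * cis t * (x1%:C * p x1 t - x0%:C * p x0 t)) y0 y1 +
   cint (fun t => 'i * cis t * (x2%:C * p x2 t - x1%:C * p x1 t)) y0 y1.
  rewrite -cintD; try exact: rcont_angular.
  by congr cint; apply/funext => t; ring.
by ring.
Qed.

Lemma contour_split_angle p x0 x1 y0 y1 y2 : pcont p -> y0 <= y1 -> y1 <= y2 ->
  contour p x0 x1 y0 y2 = contour p x0 x1 y0 y1 + contour p x0 x1 y1 y2.
Proof.
move=> cp y01 y12; rewrite /contour (cint_split (rcont_angular _ _ _ cp) y01 y12).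
have -> : cint (fun s => cis y2 * p s y2 - cis y0 * p s y0) x0 x1 =
   cint (fun s => cis y1 * p s y1 - cis y0 * p s y0) x0 x1 +
   cint (fun s => cis y2 * p s y2 - cis y1 * p s y1) x0 x1.
  rewrite -cintD; try exact: rcont_radial.
  by congr cint; apply/funext => t; ring.
by ring.
Qed.

Lemma contourD p q x0 x1 y0 y1 : pcont p -> pcont q ->
  contour (fun s t => p s t + q s t) x0 x1 y0 y1 = contour p x0 x1 y0 y1 + contour q x0 x1 y0 y1.
Proof.
move=> cp cq; rewrite /contour.
have -> : cint (fun t => 'i * cis t * (x1%:C * (p x1 t + q x1 t) - x0%:C * (p x0 t + q x0 t))) y0 y1 =
   cint (fun t => 'i * cis t * (x1%:C * p x1 t - x0%:C * p x0 t)) y0 y1 +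
   cint (fun t => 'i * cis t * (x1%:C * q x1 t - x0%:C * q x0 t)) y0 y1.
  rewrite -cintD; try exact: rcont_angular.
  by congr cint; apply/funext => t; ring.
have -> : cint (fun s => cis y1 * (p s y1 + q s y1) - cis y0 * (p s y0 + q s y0)) x0 x1 =
   cint (fun s => cis y1 * p s y1 - cis y0 * p s y0) x0 x1 +
   cint (fun s => cis y1 * q s y1 - cis y0 * q s y0) x0 x1.
  rewrite -cintD; try exact: rcont_radial.
  by congr cint; apply/funext => t; ring.
by ring.
Qed.

Definition affine_polar (c0 c1 : R[i]) x y : R[i] := c0 + c1 * (x%:C * cis y).

Lemma pcont_affine c0 c1 : pcont (affine_polar c0 c1).
Proof.
split=> [x|y]; apply: rcontD; try exact: rcont_const.
  apply: rcontM; first exact: rcont_const.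
  by apply: rcontM; [exact: rcont_const | exact: rcont_cis].
apply: rcontM; first exact: rcont_const.
by apply: rcontM; [exact: rcont_real | exact: rcont_const].
Qed.

(** Affine functions have primitives. *)
Lemma contour_affine c0 c1 x0 x1 y0 y1 : x0 <= x1 -> y0 <= y1 ->
  contour (affine_polar c0 c1) x0 x1 y0 y1 = 0.
Proof.
move=> x01 y01; rewrite /contour /affine_polar.
have icis : rcont (fun t : R => 'i * cis t).
  by apply: rcontM; [exact: rcont_const | exact: rcont_cis].
have icis2 : rcont (fun t : R => 'i * cis t * cis t).
  by apply: rcontM => //; exact: rcont_cis.
have cZ k (u : R -> R[i]) : rcont u -> rcont (fun t => k * u t).
  by move=> cu; apply: rcontM => //; exact: rcont_const.
have -> : cint (fun t => 'i * cis t * (x1%:C * (c0 + c1 * (x1%:C * cis t)) -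
      x0%:C * (c0 + c1 * (x0%:C * cis t)))) y0 y1 =
    c0 * (x1%:C - x0%:C) * (cis y1 - cis y0) +
    c1 * (x1%:C ^+ 2 - x0%:C ^+ 2) * ((cis y1 ^+ 2 - cis y0 ^+ 2) / 2).
  rewrite -cint_cis // -cint_cis2 // -!cintZ // -cintD; try exact: cZ.
  by congr cint; apply/funext => t; ring.
have -> : cint (fun s => cis y1 * (c0 + c1 * (s%:C * cis y1)) - cis y0 * (c0 + c1 * (s%:C * cis y0))) x0 x1 =
    c0 * (cis y1 - cis y0) * (x1 - x0)%:C +
    c1 * (cis y1 ^+ 2 - cis y0 ^+ 2) * ((x1 ^+ 2 - x0 ^+ 2) / 2)%:C.
  rewrite -cint_id // -cint_cst // -cintZ; last exact: rcont_real.
  rewrite -cintD; [|exact: rcont_const|apply: cZ; exact: rcont_real].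
  by congr cint; apply/funext => s; ring.
have -> : ((x1 ^+ 2 - x0 ^+ 2) / 2)%:C = (x1%:C ^+ 2 - x0%:C ^+ 2) / 2 :> R[i].
  by rewrite rmorphM /= fmorphV /= rmorph_nat rmorphB /= !rmorphXn.
by rewrite rmorphB /=; ring.
Qed.

Lemma contour_bound p x0 x1 y0 y1 K : pcont p -> 0 <= K -> 0 <= x0 -> x0 <= x1 -> x1 <= 1 -> y0 <= y1 ->
  (forall s t, x0 <= s <= x1 -> y0 <= t <= y1 -> normc (p s t) <= K) ->
  normc (contour p x0 x1 y0 y1) <= 4 * K * ((x1 - x0) + (y1 - y0)).
Proof.
move=> cp K0 x0p x01 x1p y01 pK; rewrite /contour.
apply: le_trans (normcB _ _) _.
have h1 : normc (cint (fun t => 'i * cis t * (x1%:C * p x1 t - x0%:C * p x0 t)) y0 y1) <= 2 * (2 * K) * (y1 - y0).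
  apply: cint_bound => //; first exact: rcont_angular.
  move=> t ty; rewrite !normcM normc_cis mulr1.
  have -> : normc ('i : R[i]) = 1 by rewrite /normc /= expr0n /= expr1n add0r sqrtr1.
  rewrite mul1r; apply: le_trans (normcB _ _) _.
  have x1p' : 0 <= x1 := le_trans x0p x01.
  have x01' : x0 <= 1 := le_trans x01 x1p.
  rewrite mulr_natl mulr2n !normcM !normc_pos // lerD //.
    by rewrite -[leRHS]mul1r ler_pM ?normc_ge0 //; apply: pK => //; rewrite x01 lexx.
  by rewrite -[leRHS]mul1r ler_pM ?normc_ge0 //; apply: pK => //; rewrite x01 lexx.
have h2 : normc (cint (fun s => cis y1 * p s y1 - cis y0 * p s y0) x0 x1) <= 2 * (2 * K) * (x1 - x0).
  apply: cint_bound => //; first exact: rcont_radial.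
  move=> s sx; apply: le_trans (normcB _ _) _.
  by rewrite mulr_natl mulr2n !normcM !normc_cis !mul1r lerD // pK // y01 lexx.
lra.
Qed.

End PolarContour.

(** * Cauchy's theorem on a circle *)

Section Cauchy.
Context {R : realType}.
Implicit Types (z w c : R[i]) (s t x y : R).
Variables (h : R[i] -> R[i]) (r : R).
Hypotheses (r0 : 0 < r) (r1 : r < 1) (hd : forall z, unit_disc z -> holo_at h z).

(** Radii are truncated to [[0, r]], to obtain functions that are continuous for
all values of the polar coordinates. *)
Let cl x : R := Num.min (Num.max x 0) r.

Let cl_bounds x : 0 <= cl x <= r.
Proof. by rewrite /cl le_min ge_min le_max !lexx !orbT (ltW r0). Qed.

Let cl_id x : 0 <= x <= r -> cl x = x.
Proof. by move=> /andP[x0 xr]; rewrite /cl max_l // min_l. Qed.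

Let clP x : [\/ x <= 0 /\ cl x = 0, 0 <= x <= r /\ cl x = x | r <= x /\ cl x = r].
Proof.
have [x0|/ltW x0] := leP x 0.
  by apply: Or31; rewrite /cl max_r // min_l // ltW.
have [xr|/ltW xr] := leP x r.
  by apply: Or32; rewrite cl_id ?x0.
by apply: Or33; rewrite /cl max_l // min_r.
Qed.

Let cl_lip x y : `|cl x - cl y| <= `|x - y|.
Proof.
have r0' := r0; have h1 := ler_norm (x - y); have h2 := ler_norm (y - x).
rewrite (distrC y x) in h2; rewrite ler_norml.
by case: (clP x) => -[? ->]; case: (clP y) => -[? ->]; lra.
Qed.

Let point x y : R[i] := (cl x)%:C * cis y.

Let point_disc x y : unit_disc (point x y).
Proof.
rewrite /unit_disc /= -[1]/(1%:C) norm_ltC /point normcM normc_cis mulr1.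
by have /andP[c0 cr] := cl_bounds x; rewrite normc_pos // (le_lt_trans cr).
Qed.

Let point_dist x y x' y' : normc (point x y - point x' y') <= `|x - x'| + 2 * `|y - y'|.
Proof.
have -> : point x y - point x' y' = (cl x - cl x')%:C * cis y + (cl x')%:C * (cis y - cis y').
  by rewrite /point rmorphB /=; ring.
have /andP[c0 cr] := cl_bounds x'.
apply: le_trans (normcD _ _) _; rewrite !normcM normc_cis mulr1 normc_real normc_pos // lerD ?cl_lip //.
apply: le_trans (cis_lip y y'); rewrite ler_piMl ?normc_ge0 //.
by apply: le_trans cr (ltW r1).
Qed.

Let hp x y := h (point x y).

Let pcont_hp : pcont hp.
Proof.
split=> [x|y]; apply: econt_rcont => t e e0.
  have [d d0 hcd] := holo_continuous (hd (point_disc x t)) e0.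
  exists (d / 2); first by rewrite divr_gt0.
  move=> s st; apply: hcd; have := point_dist x s x t; rewrite subrr normr0; lra.
have [d d0 hcd] := holo_continuous (hd (point_disc t y)) e0.
exists d => // s st; apply: hcd; have := point_dist s y t y; rewrite subrr normr0; lra.
Qed.

(** The affine part of [h] at the point contributes nothing, and the remainder is
small compared with the diameter of the rectangle. *)
Let contour_local x y : 0 <= x <= r -> 0 <= y <= 2 * pi -> forall e : R, 0 < e ->
  exists2 d : R, 0 < d & forall x0 x1 y0 y1, 0 <= x0 <= x -> x <= x1 <= r ->
    0 <= y0 <= y -> y <= y1 <= 2 * pi -> x1 - x0 < d -> y1 - y0 < d ->
    normc (contour hp x0 x1 y0 y1) <= e * ((x1 - x0) + (y1 - y0)) ^+ 2.
Proof.
move=> xr yp e e0; have [c hc] := hd (point_disc x y).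
have e8 : 0 < e / 8 by lra.
have [d d0 hcd] := hc _ e8.
exists (d / 3); first by rewrite divr_gt0.
move=> x0 x1 y0 y1 /andP[x00 x0x] /andP[xx1 x1r] /andP[y00 y0y] /andP[yy1 y1p] dx dy.
pose A := affine_polar (h (point x y) - c * point x y) c.
pose err s t := hp s t - A s t.
have cA : pcont A by exact: pcont_affine.
have cerr : pcont err.
  by split=> [u|u]; apply: rcontB; [case: pcont_hp => k _; exact: k | case: cA => k _; exact: k
    | case: pcont_hp => _ k; exact: k | case: cA => _ k; exact: k].
have -> : hp = (fun s t => A s t + err s t).
  by apply/funext => s; apply/funext => t; rewrite /err addrC subrK.
have x01 : x0 <= x1 by lra.
have y01 : y0 <= y1 by lra.
rewrite contourD // contour_affine // add0r.
set D := (x1 - x0) + (y1 - y0).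
have D0 : 0 <= D by rewrite /D; lra.
have errK s t : x0 <= s <= x1 -> y0 <= t <= y1 -> normc (err s t) <= e / 8 * (2 * D).
  move=> /andP[s0 s1] /andP[t0 t1].
  have sx : `|s - x| <= x1 - x0 by rewrite ler_norml; lra.
  have ty : `|t - y| <= y1 - y0 by rewrite ler_norml; lra.
  have dd := point_dist s t x y.
  have -> : err s t = h (point s t) - h (point x y) - c * (point s t - point x y).
    have sE : cl s = s by apply: cl_id; rewrite (le_trans x00 s0) (le_trans s1).
    by rewrite /err /hp /A /affine_polar /point sE; ring.
  apply: le_trans (hcd _ _) _; first by lra.
  by rewrite ler_wpM2l ?(ltW e8) //; rewrite /D; lra.
have K0 : 0 <= e / 8 * (2 * D) by rewrite mulr_ge0 ?(ltW e8) // mulr_ge0.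
have x1p : x1 <= 1 by rewrite (le_trans x1r) // ltW.
apply: le_trans (contour_bound cerr K0 x00 x01 x1p y01 errK) _.
by rewrite -/D le_eqVlt; apply/orP; left; apply/eqP; field.
Qed.

(** The rectangle of radii from 0 to [r] and of angles from 0 to [2 * pi]: the two
radial sides cancel, the inner circle is a point, and only the outer circle
remains. *)
Lemma cauchy_circle : cint (fun t => cis t * h (r%:C * cis t)) 0 (2 * pi) = 0.
Proof.
have pi0 : 0 <= 2 * pi :> R by rewrite mulr_ge0 // ltW // pi_gt0.
have := bisection (ltW r0) pi0
  (fun x0 x1 x2 y0 y1 a b _ => contour_split_radius y0 y1 pcont_hp a b)
  (fun x0 x1 y0 y1 y2 _ a b => contour_split_angle x0 x1 pcont_hp a b) contour_local.
rewrite /contour cis2pi cis0.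
have -> : (fun s => 1 * hp s (2 * pi) - 1 * hp s 0) = (fun=> 0).
  by apply/funext => s; rewrite /hp /point cis2pi cis0 subrr.
rewrite cint_cst ?(ltW r0) // mul0r subr0.
have rr : 0 <= r <= r by rewrite lexx (ltW r0).
have cf : rcont (fun t => cis t * h (r%:C * cis t)).
  apply: rcontM; first exact: rcont_cis.
  have -> : (fun t => h (r%:C * cis t)) = hp r by apply/funext => t; rewrite /hp /point cl_id.
  by case: pcont_hp.
have -> : (fun t => 'i * cis t * (r%:C * hp r t - 0%:C * hp 0 t)) =
    (fun t => ('i * r%:C) * (cis t * h (r%:C * cis t))).
  by apply/funext => t; rewrite /hp /point (cl_id rr) mul0r subr0; ring.
rewrite cintZ // => /eqP; rewrite mulf_eq0 => /orP[|/eqP //].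
rewrite mulf_eq0 !eq_complex /= !eqxx oner_eq0 andbF andbT /=.
by rewrite gt_eqF.
Qed.

End Cauchy.

(** * Consequences of almost everywhere convergence *)

Section Boundary.
Context {R : realType}.
Implicit Types (z w c : R[i]) (r s t : R).
Local Notation mu := (@lebesgue_measure R).

Lemma econt_normc q : econt q -> continuous (fun t => normc (q t)).
Proof.
move=> cq t; apply/cvgrPdist_lt => e e0; have [d d0 hd] := cq t e e0.
apply/nbhs_ballP; exists d => //= s; rewrite /ball /= distrC => /hd; apply: le_lt_trans.
have h1 := normc_tri (q t) (q s) 0; have h2 := normc_tri (q s) (q t) 0.
rewrite !subr0 in h1 h2; rewrite (normcBC (q t)) in h2.
by rewrite ler_norml; lra.
Qed.

Lemma econtB p q : econt p -> econt q -> econt (fun t => p t - q t).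
Proof.
move=> cp cq t e e0; have e20 : 0 < e / 2 by lra.
have [d1 d10 h1] := cp t _ e20; have [d2 d20 h2] := cq t _ e20.
exists (Num.min d1 d2); first by rewrite lt_min d10.
move=> s; rewrite lt_min => /andP[/h1 k1 /h2 k2].
rewrite (_ : _ - _ = (p s - p t) - (q s - q t)); last by ring.
by apply: le_lt_trans (normcB _ _) _; lra.
Qed.

Lemma econt_circle u : unif_circle u -> econt (fun t => u (cis t)).
Proof.
move=> cu t e e0; have [d d0 hd] := cu e e0; exists (d / 2); first by rewrite divr_gt0.
move=> s st; apply: hd; [exact: circle_cis | exact: circle_cis |].
by apply: le_lt_trans (cis_lip s t) _; lra.
Qed.

Lemma econt_dilation (h : R[i] -> R[i]) r : 0 < r < 1 ->
  (forall z, unit_disc z -> holo_at h z) -> econt (fun t => h (r%:C * cis t)).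
Proof.
move=> /andP[r0 r1] hd t e e0.
have rt : unit_disc (r%:C * cis t).
  by rewrite /unit_disc /= -[1]/(1%:C) norm_ltC normcM normc_cis mulr1 normc_pos // ltW.
have [d d0 hdd] := holo_continuous (hd _ rt) e0.
exists (d / 2); first by rewrite divr_gt0.
move=> s st; apply: hdd; rewrite -mulrBr normcM normc_pos ?(ltW r0) //.
have := cis_lip s t; have := normc_ge0 (cis s - cis t : R[i]); nra.
Qed.

(** Dominated convergence for integrals, read on Riemann sums. *)
Lemma small_averages (u : nat -> R -> R[i]) (B : R) :
  (forall n, econt (u n)) -> (forall n t, normc (u n t) <= B) ->
  {ae mu, forall t, 0 <= t < 2 * pi -> normc (u n t) @[n --> \oo] --> (0 : R)} ->
  forall e : R, 0 < e -> exists n0, forall n, (n0 <= n)%N ->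
    exists N0, forall N, (N0 <= N)%N ->
      N%:R^-1 * \sum_(j < N) normc (u n (2 * pi * j%:R / N%:R)) <= e.
Proof.
move=> cu uB u0 e e0.
have cnu n := econt_normc (cu n).
have := itg_dominated cnu (fun n t => introT andP (conj (normc_ge0 (u n t)) (uB n t))) u0.
have pi0 : 0 < 2 * pi :> R by rewrite mulr_gt0 // pi_gt0.
have ep : 0 < pi * e :> R by rewrite mulr_gt0 // pi_gt0.
move=> /cvgrPdist_lt/(_ _ ep)[n0 _ hn0]; exists n0 => n nn0.
have e20 : 0 < e / 2 by lra.
have [N0 hN0] := riemann_sum (cnu n) e20; exists N0 => N NN0.
have := hN0 N NN0; have := hn0 n nn0; rewrite /= sub0r normrN.
have : (2 * pi)^-1 * (pi * e) = e / 2 :> R.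
  by have := pi_gt0 R; move: (pi) => p p0; field; rewrite gt_eqF.
set I := itg _ _ _; move=> pe hI; have : (2 * pi)^-1 * I <= e / 2.
  by rewrite -pe ler_wpM2l ?invr_ge0 ?(ltW pi0) // ltW // (le_lt_trans (ler_norm _)).
by rewrite ler_norml; lra.
Qed.

Lemma riemann_sumC (q : R -> R[i]) : rcont q -> cint q 0 (2 * pi) = 0 ->
  forall e : R, 0 < e -> exists N0, forall N, (N0 <= N)%N ->
    normc (N%:R^-1 * \sum_(j < N) q (2 * pi * j%:R / N%:R)) <= e.
Proof.
move=> [c1 c2] [I1 I2] e e0; have e20 : 0 < e / 2 by lra.
have [N1 h1] := riemann_sum c1 e20; have [N2 h2] := riemann_sum c2 e20.
exists (maxn N1 N2) => N; rewrite geq_max => /andP[/h1 k1 /h2 k2].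
rewrite I1 mulr0 subr0 in k1; rewrite I2 mulr0 subr0 in k2.
apply: le_trans (normc_ReIm _) _.
rewrite -(rmorph_nat (real_complex R)) -fmorphV ReZ ImZ Re_sum.
have -> : Im (\sum_(j < N) q (2 * pi * j%:R / N%:R)) = \sum_(j < N) Im (q (2 * pi * j%:R / N%:R)).
  by elim/big_rec2: _ => [//|i x y _ <-]; rewrite ImD.
lra.
Qed.

Section BoundaryConvergence.
Variables (M : R) (F : nat -> R[i] -> R[i]) (g : R[i] -> R[i]).
Hypotheses (Fu : forall n, unif_circle (F n)).
Hypothesis FM : forall n z, unit_circle z -> normc (F n z) <= M.
Hypothesis g_analytic : bounded_analytic g.
Hypothesis Fg : circle_ae (fun z =>
  exists w, boundary_value g z w /\ (F n z @[n --> \oo] --> w)).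

(** Otherwise there would be two sequences of indices along which the mean
distance does not tend to 0, although the difference tends to 0 almost
everywhere. *)
Lemma cauchy_in_mean (e : R) : 0 < e ->
  exists n0, forall n m, (n0 <= n)%N -> (n0 <= m)%N ->
  exists N0, forall N, (N0 <= N)%N -> avg N (fun z => normc (F n z - F m z)) <= e.
Proof.
move=> e0; apply: contrapT => hn.
have /choice[nm hnm] : forall k : nat, exists nm : nat * nat,
    [/\ (k <= nm.1)%N, (k <= nm.2)%N & ~ exists N0, forall N, (N0 <= N)%N ->
      avg N (fun z => normc (F nm.1 z - F nm.2 z)) <= e].
  move=> k; apply: contrapT => hk; apply: hn; exists k => n m kn km.
  by apply: contrapT => h; apply: hk; exists (n, m).
pose u k t := F (nm k).1 (cis t) - F (nm k).2 (cis t).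
have cu k : econt (u k) by apply: econtB; exact: econt_circle.
have uB k t : normc (u k t) <= M + M.
  by apply: le_trans (normcB _ _) _; rewrite lerD // FM //; exact: circle_cis.
have u0 : {ae mu, forall t, 0 <= t < 2 * pi -> normc (u n t) @[n --> \oo] --> (0 : R)}.
  apply: (@filterS _ _ (ae_filter_ringOfSetsType mu) _ _ _ Fg) => t ht t0.
  have [w [_ /cvg_seqP hw]] := ht t0.
  apply/cvgrPdist_lt => d d0; have d20 : 0 < d / 2 by lra.
  have [N hN] := hw _ d20; exists N => // k /= Nk.
  have [k1 k2 _] := hnm k.
  have h1 := hN _ (leq_trans Nk k1); have h2 := hN _ (leq_trans Nk k2).
  rewrite sub0r normrN ger0_norm ?normc_ge0 //.
  have := normc_tri w (F (nm k).1 (cis t)) (F (nm k).2 (cis t)).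
  by rewrite (normcBC w) /u; lra.
have [k hk] := small_averages cu uB u0 e0.
by have [_ _] := hnm k; apply; exact: hk.
Qed.

Let rad (n : nat) : R := 1 - n.+2%:R^-1.

Let rad01 n : 0 < rad n < 1.
Proof.
have n2 : 1 < n.+2%:R :> R by rewrite ltr1n.
have n0 : 0 < n.+2%:R :> R by lra.
rewrite /rad; apply/andP; split; last by rewrite ltrBlDr ltrDl invr_gt0.
by rewrite subr_gt0 invf_lt1.
Qed.

Lemma dilation_averages (e : R) : 0 < e ->
  exists n0, forall n, (n0 <= n)%N ->
  exists N0, forall N, (N0 <= N)%N -> avg N (fun z => normc (F n z - g ((rad n)%:C * z))) <= e.
Proof.
move=> e0; have [gder [B gB]] := g_analytic.
have gd z : unit_disc z -> holo_at g z by move=> /gder/derivable_holo.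
pose u n t := F n (cis t) - g ((rad n)%:C * cis t).
have cu n : econt (u n).
  by apply: econtB; [exact: econt_circle | exact: econt_dilation (rad01 n) gd].
have uB n t : normc (u n t) <= M + B.
  apply: le_trans (normcB _ _) _; rewrite lerD // ?FM //; first exact: circle_cis.
  rewrite -norm_leC; apply: gB.
  have /andP[r0 r1] := rad01 n.
  by rewrite /unit_disc /= -[1]/(1%:C) norm_ltC normcM normc_cis mulr1 normc_pos // ltW.
have u0 : {ae mu, forall t, 0 <= t < 2 * pi -> normc (u n t) @[n --> \oo] --> (0 : R)}.
  apply: (@filterS _ _ (ae_filter_ringOfSetsType mu) _ _ _ Fg) => t ht t0.
  have [w [/boundary_valueP gw /cvg_seqP hw]] := ht t0.
  apply/cvgrPdist_lt => d d0; have d20 : 0 < d / 2 by lra.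
  have [N hN] := hw _ d20; have [rho rho0 hrho] := gw _ d20.
  exists (maxn N (Num.bound rho^-1)) => // k /=; rewrite geq_max => /andP[Nk rk].
  have h1 := hN _ Nk.
  have h2 : normc (g ((rad k)%:C * cis t) - w) < d / 2.
    apply: hrho; have /andP[_ ->] := rad01 k; rewrite andbT /rad.
    rewrite ltrD2l ltrN2 invf_plt ?posrE // ?ltr0n //.
    apply: lt_le_trans (unstable.ltr_bound _) _; rewrite ler_nat.
    by rewrite (leq_trans rk) // ltnW.
  rewrite sub0r normrN ger0_norm ?normc_ge0 //.
  have := normc_tri w (F k (cis t)) (g ((rad k)%:C * cis t)).
  by rewrite (normcBC w) /u; lra.
exact: small_averages cu uB u0 e e0.
Qed.

(** Cauchy's theorem for the function [z ^+ j * g z]. *)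
Lemma dilation_moment j r (e : R) : 0 < r < 1 -> 0 < e ->
  exists N0, forall N, (N0 <= N)%N -> normc (avg N (fun z => g (r%:C * z) * z ^+ j.+1)) <= e.
Proof.
move=> r01 e0; have /andP[r0 r1] := r01; have [gder _] := g_analytic.
have gd z : unit_disc z -> holo_at g z by move=> /gder/derivable_holo.
pose h z := z ^+ j * g z.
have hd z : unit_disc z -> holo_at h z by move=> /gd; exact: holo_mulX.
have rcis : rcont (cis : R -> R[i]) by exact: rcont_cis.
have cg : rcont (fun t => g (r%:C * cis t)) by apply: econt_rcont; exact: econt_dilation.
have cX k : rcont (fun t : R => cis t ^+ k : R[i]).
  elim: k => [|k IH]; first by under eq_fun do rewrite expr0; exact: rcont_const.
  by under eq_fun do rewrite exprS; exact: rcontM.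
have cq : rcont (fun t => g (r%:C * cis t) * cis t ^+ j.+1) by exact: rcontM.
have I0 : cint (fun t => g (r%:C * cis t) * cis t ^+ j.+1) 0 (2 * pi) = 0.
  have := cauchy_circle r0 r1 hd.
  have -> : (fun t => cis t * h (r%:C * cis t)) =
      (fun t => (r%:C ^+ j) * (g (r%:C * cis t) * cis t ^+ j.+1)).
    by apply/funext => t; rewrite /h exprMn exprS; ring.
  rewrite cintZ // => /eqP; rewrite mulf_eq0 => /orP[|/eqP //].
  by rewrite expf_eq0 eq_complex /= eqxx andbT (gt_eqF r0) andbF.
exact: riemann_sumC cq I0 e e0.
Qed.

Lemma negative_coefficients j : (0 < j)%N -> forall e : R, 0 < e ->
  exists n0, forall n, (n0 <= n)%N ->
  exists N0, forall N, (N0 <= N)%N -> normc (avg N (fun z => F n z * z ^+ j)) <= e.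
Proof.
case: j => // j _ e e0; have e20 : 0 < e / 2 by lra.
have [n0 hn0] := dilation_averages e20; exists n0 => n nn0.
have [N1 h1] := hn0 n nn0.
have [N2 h2] := dilation_moment j (rad01 n) e20.
exists (maxn N1 N2) => N; rewrite geq_max => /andP[/h1 k1 /h2 k2].
have -> : avg N (fun z => F n z * z ^+ j.+1) =
    avg N (fun z => (F n z - g ((rad n)%:C * z)) * z ^+ j.+1) +
    avg N (fun z => g ((rad n)%:C * z) * z ^+ j.+1).
  by rewrite -avgD; apply: eq_avg => z _; ring.
apply: le_trans (normcD _ _) _.
have : normc (avg N (fun z => (F n z - g ((rad n)%:C * z)) * z ^+ j.+1)) <= e / 2.
  apply: le_trans (normc_avg _ _) _; apply: le_trans k1; apply: le_avg => z /circleE z1.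
  by rewrite normcM normcX z1 expr1n mulr1.
lra.
Qed.

End BoundaryConvergence.
End Boundary.

Theorem corollary1 (R : realType) (M : R) (E : set R[i]) (f g : R[i] -> R[i])
    (F : nat -> R[i] -> R[i])
    (M_gt0 : 0 < M)
    (mE : circle_measurable E)
    (g_analytic : bounded_analytic g)
    (g_boundary : circle_ae (fun z => E z -> boundary_value g z (f z)))
    (F_continuous : forall n, {within unit_circle, continuous (F n)})
    (F_bounded : forall n z, unit_circle z -> `|F n z| <= M%:C)
    (F_cvg : forall z, E z -> F n z @[n --> \oo] --> f z)
    (F_cvg_ae : circle_ae (fun z => ~ E z ->
       exists w, boundary_value g z w /\ (F n z @[n --> \oo] --> w))) :
  exists P : nat -> {poly R[i]},
    (forall z, E z -> (P n).[z] @[n --> \oo] --> f z) /\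
    (forall n z, unit_disc z -> `|(P n).[z]| <= M%:C).
Proof.
have Fu n : unif_circle (F n) by exact: continuous_unif_circle.
have FM n z : unit_circle z -> normc (F n z) <= M by rewrite -norm_leC; exact: F_bounded.
have Fg : circle_ae (fun z => exists w, boundary_value g z w /\ (F n z @[n --> \oo] --> w)).
  apply: (@filterS2 _ _ (ae_filter_ringOfSetsType lebesgue_measure) _ _ _ _ g_boundary F_cvg_ae).
  move=> t hb hc t0; have [Et|nEt] := pselect (E (cis t)); last exact: hc.
  by exists (f (cis t)); split; [exact: hb | exact: F_cvg].
apply: (pointwise_approximation M_gt0 Fu FM _ (proj1 mE) F_cvg) => eps eta.
apply: (polynomial_close_off_cover M_gt0 Fu FM).
  by move=> e; exact: cauchy_in_mean Fu FM Fg e.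
by move=> j j0 e; exact: negative_coefficients Fu FM g_analytic Fg j j0 e.
Qed.
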